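(* There is a universal constant $K_4>0$ such that for all $\alpha_m>0$, $\theta\in(0,1)$ and $h,\alpha_s,\eta>0$, the two-dimensional minimal energy satisfies \[ E_{h,\alpha_s,\eta,\theta}\ge K_4\min\left(\alpha_m\eta^2\theta^3,\ \alpha_s^{2/3}\eta^{5/3}\theta^{8/3}\right)h . \]
   Context: Let $\mathbb T^2=\mathbb R^2/\mathbb Z^2$. Fix parameters $\alpha_m>0$, $h>0$ (nondimensionalized thickness), $\alpha_s>0$ (compliance ratio), $\eta>0$ (mismatch strain), $\theta\in(0,1)$. The admissible class $\mathcal A$ consists of triples $(w,u,\Omega)$ with $w\in H^1(\mathbb T^2;\mathbb R^2)$, $u\in H^2(\mathbb T^2;[0,\infty))$, $\Omega\subset\mathbb T^2$ closed with $|\Omega|=\theta$ (Lebesgue measure), and $u=0$ on $\Omega$. With $e(w)=\frac12(\nabla w+\nabla w^T)$, $I$ the $2\times2$ identity and $|\cdot|$ the Frobenius norm, the energy is \[ E_{ND}[w,u,\Omega]=\alpha_m h\int_{\mathbb T^2}\Big|e(w)+\tfrac12\nabla u\otimes\nabla u-\eta I\Big|^2dx+h^3\int_{\mathbb T^2}|D^2u|^2dx+\alpha_s\Big(\int_\Omega|\nabla w|^2dx\Big)^{1/2}\Big(\int_\Omega|w|^2dx\Big)^{1/2}, \] and $E_{h,\alpha_s,\eta,\theta}:=\inf_{(w,u,\Omega)\in\mathcal A}E_{ND}[w,u,\Omega]$. *)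

(* Defs.v *)
From HB Require Import structures.
From mathcomp Require Import all_boot all_order all_algebra.
From mathcomp Require Import all_classical all_reals all_analysis.
Set Implicit Arguments. Unset Strict Implicit. Unset Printing Implicit Defensive.
Import Order.TTheory GRing.Theory Num.Theory.
Import numFieldNormedType.Exports.
Local Open Scope classical_set_scope.
Local Open Scope ring_scope.

(* The flat torus T^2 = R^2/Z^2 is modelled by Z^2-periodic objects on R*R;
   integrals over T^2 are integrals over the unit cell [0,1)^2 w.r.t. the
   two-dimensional Lebesgue (product) measure. *)

Definition leb2 (R : realType) :=
  ((@lebesgue_measure R) \x (@lebesgue_measure R))%E.

Definition cell (R : realType) : set (R * R) := `[0%R, 1%R[ `*` `[0%R, 1%R[.

Definition periodic (R : realType) (T : Type) (f : R * R -> T) : Prop :=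
  forall x y : R, f (x + 1, y) = f (x, y) /\ f (x, y + 1) = f (x, y).

Definition periodic_set (R : realType) (A : set (R * R)) : Prop :=
  forall x y : R, (A (x + 1, y) <-> A (x, y)) /\ (A (x, y + 1) <-> A (x, y)).

Definition dx (R : realType) (f : R * R -> R) : R * R -> R :=
  fun p => derive1 (fun t : R => f (t, p.2)) p.1.
Definition dy (R : realType) (f : R * R -> R) : R * R -> R :=
  fun p => derive1 (fun t : R => f (p.1, t)) p.2.

Fixpoint Cn (R : realType) (n : nat) (f : R * R -> R) : Prop :=
  match n with
  | O => continuous f
  | S n' => continuous f /\
      (forall p : R * R, derivable (fun t : R => f (t, p.2)) p.1 1 /\
                         derivable (fun t : R => f (p.1, t)) p.2 1) /\
      Cn n' (dx f) /\ Cn n' (dy f)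
  end.

Definition test_fun (R : realType) (phi : R * R -> R) : Prop :=
  (forall n, Cn n phi) /\ periodic phi.

Definition L2 (R : realType) (f : R * R -> R) : Prop :=
  measurable_fun setT f /\
  (\int[@leb2 R]_(p in @cell R) ((f p) ^+ 2)%:E < +oo)%E.

Definition weak_dx (R : realType) (f g : R * R -> R) : Prop :=
  forall phi, test_fun phi ->
  (\int[@leb2 R]_(p in @cell R) (f p * dx phi p)%:E
     = - \int[@leb2 R]_(p in @cell R) (g p * phi p)%:E)%E.
Definition weak_dy (R : realType) (f g : R * R -> R) : Prop :=
  forall phi, test_fun phi ->
  (\int[@leb2 R]_(p in @cell R) (f p * dy phi p)%:E
     = - \int[@leb2 R]_(p in @cell R) (g p * phi p)%:E)%E.

Definition H1 (R : realType) (f fx fy : R * R -> R) : Prop :=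
  periodic f /\ L2 f /\ L2 fx /\ L2 fy /\ weak_dx f fx /\ weak_dy f fy.

(* A candidate triple (w,u,Omega) together with the weak derivatives of w and
   the weak first and second derivatives of u. *)
Record cand (R : realType) := Cand {
  w1 : R * R -> R; w2 : R * R -> R;
  w1x : R * R -> R; w1y : R * R -> R; w2x : R * R -> R; w2y : R * R -> R;
  u : R * R -> R; ux : R * R -> R; uy : R * R -> R;
  uxx : R * R -> R; uxy : R * R -> R; uyx : R * R -> R; uyy : R * R -> R;
  Om : set (R * R) }.

Definition admissible (R : realType) (theta : R) (c : cand R) : Prop :=
  H1 (w1 c) (w1x c) (w1y c) /\ H1 (w2 c) (w2x c) (w2y c) /\
  (* u in H^2(T^2;[0,oo)), taken as its continuous representative *)
  continuous (u c) /\ (forall p, 0 <= u c p) /\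
  H1 (u c) (ux c) (uy c) /\ H1 (ux c) (uxx c) (uxy c) /\
  H1 (uy c) (uyx c) (uyy c) /\
  closed (Om c) /\ periodic_set (Om c) /\
  @leb2 R (Om c `&` @cell R) = theta%:E /\
  (forall p, Om c p -> u c p = 0).

(* entries of  e(w) + 1/2 grad u (x) grad u - eta I *)
Definition M11 (R : realType) (eta : R) (c : cand R) (p : R * R) : R :=
  w1x c p + (ux c p) ^+ 2 / 2 - eta.
Definition M12 (R : realType) (c : cand R) (p : R * R) : R :=
  (w1y c p + w2x c p) / 2 + ux c p * uy c p / 2.
Definition M21 (R : realType) (c : cand R) (p : R * R) : R :=
  (w2x c p + w1y c p) / 2 + uy c p * ux c p / 2.
Definition M22 (R : realType) (eta : R) (c : cand R) (p : R * R) : R :=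
  w2y c p + (uy c p) ^+ 2 / 2 - eta.

Definition E_ND (R : realType) (alpha_m h alpha_s eta : R) (c : cand R) : \bar R :=
  ((alpha_m * h)%:E *
     \int[@leb2 R]_(p in @cell R)
        ((M11 eta c p) ^+ 2 + (M12 c p) ^+ 2 + (M21 c p) ^+ 2
           + (M22 eta c p) ^+ 2)%:E
   + (h ^+ 3)%:E *
     \int[@leb2 R]_(p in @cell R)
        ((uxx c p) ^+ 2 + (uxy c p) ^+ 2 + (uyx c p) ^+ 2 + (uyy c p) ^+ 2)%:E
   + alpha_s%:E *
     sqrte (\int[@leb2 R]_(p in Om c `&` @cell R)
        ((w1x c p) ^+ 2 + (w1y c p) ^+ 2 + (w2x c p) ^+ 2 + (w2y c p) ^+ 2)%:E) *
     sqrte (\int[@leb2 R]_(p in Om c `&` @cell R)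
        ((w1 c p) ^+ 2 + (w2 c p) ^+ 2)%:E))%E.

Definition E_min (R : realType) (alpha_m h alpha_s eta theta : R) : \bar R :=
  ereal_inf [set E_ND alpha_m h alpha_s eta c | c in admissible theta].

(* Main.v *)
Require Import Defs.
From HB Require Import structures.
From mathcomp Require Import all_boot all_order all_algebra.
From mathcomp Require Import all_classical all_reals all_analysis.
From mathcomp Require Import measurable_realfun ring lra.
Set Implicit Arguments. Unset Strict Implicit. Unset Printing Implicit Defensive.
Import Order.TTheory GRing.Theory Num.Theory.
Import numFieldNormedType.Exports.
Local Open Scope classical_set_scope.
Local Open Scope ring_scope.

(* Only the second component of [w] and derivatives in the second variable matter.
   Let m = d_y w_2 + (d_y u)^2 / 2 - eta be the (2,2) entry of the strain, and assume that
   the integral of m^2 is at most (eta theta / 32)^2, since otherwise the first term of the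
   minimum is a lower bound.  Almost every vertical line is cut into n intervals J.  If J meets
   Omega, then d_y u vanishes at a point of J, because u >= 0 vanishes there; so unless the
   bending energy on J exceeds eta n, one has (d_y u)^2 <= eta on J, and w_2 increases on J with
   slope at least eta / 2, up to an error m.  Hence w_2 is small only on a small part of J.
   Summing over J and integrating, with n^2 of order B / (eta theta) where B is the integral
   of (d_yy u)^2, gives a lower bound on the integral A of w_2^2 over Omega:
   A B >= c eta^3 theta^4.  The case n = 1 together with the periodicity of w_2 gives
   B >= c eta theta, and d_y u = 0 on Omega gives D >= c eta^2 theta for the integral D of
   (d_y w_2)^2 over Omega.  So A B D >= c eta^5 theta^5, and one concludes by comparing
   h^3 B with alpha_s sqrt(D A).
   The restriction to lines rests on the absolute continuity of weakly differentiable functions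
   on almost every line, obtained by testing with products of smooth periodic sigmoids. *)

(** * Smooth periodic test functions *)

(** The whole sequence of derivatives is the witness, so that differentiating a product of two
    functions of one variable each amounts to shifting an index. *)
Definition smooth (R : realType) (f : R -> R) : Prop :=
  exists d : nat -> R -> R, d 0%N = f /\
    forall n (y : R), is_derive y 1 (d n) (d n.+1 y).

Lemma smooth_cst (R : realType) (a : R) : smooth (fun _ : R => a).
Proof.
exists (fun n _ => if n is 0%N then a else 0); split=> // n y.
by case: n => [|n]; exact: is_derive_cst.
Qed.

Lemma is_derive_continuous (R : realType) (f : R -> R) (y a : R) :
  is_derive y 1 f a -> {for y, continuous f}.
Proof. by case=> df _; apply: differentiable_continuous; exact/derivable1_diffP. Qed.

(** Both indices are general because a partial derivative of a tensor product is a tensor product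
    with one index raised; the induction on [n] needs this closure. *)
Lemma Cn_tensor (R : realType) (n : nat) (d e : nat -> R -> R) :
  (forall n (y : R), is_derive y 1 (d n) (d n.+1 y)) ->
  (forall n (y : R), is_derive y 1 (e n) (e n.+1 y)) ->
  forall i j, Cn n (fun p => d i p.1 * e j p.2).
Proof.
move=> hd he.
have cont i j : continuous (fun p : R * R => d i p.1 * e j p.2).
  move=> p; apply: cvgM.
    apply: (@cvg_comp _ _ _ fst (d i)); first exact: cvg_fst.
    exact: is_derive_continuous (hd i p.1).
  apply: (@cvg_comp _ _ _ snd (e j)); first exact: cvg_snd.
  exact: is_derive_continuous (he j p.2).
have derx i j (p : R * R) :
    is_derive p.1 1 (fun t : R => d i t * e j p.2) (d i.+1 p.1 * e j p.2).
  have H := hd i p.1; apply: is_derive_eq.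
  by rewrite /GRing.scale /=; ring.
have dery i j (p : R * R) :
    is_derive p.2 1 (fun t : R => d i p.1 * e j t) (d i p.1 * e j.+1 p.2).
  have H := he j p.2; apply: is_derive_eq.
  by rewrite /GRing.scale /=; ring.
elim: n => [|n IH] i j /=; first exact: cont.
split; first exact: cont.
split; first by move=> p; split; [have [] := derx i j p | have [] := dery i j p].
split.
- suff -> : dx (fun p => d i p.1 * e j p.2) = (fun p => d i.+1 p.1 * e j p.2) by [].
  by apply/funext => p; rewrite /dx derive1E; apply: derive_val; exact: derx.
- suff -> : dy (fun p => d i p.1 * e j p.2) = (fun p => d i p.1 * e j.+1 p.2) by [].
  by apply/funext => p; rewrite /dy derive1E; apply: derive_val; exact: dery.
Qed.

Lemma test_fun_tensor (R : realType) (psi phi : R -> R) :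
  smooth psi -> smooth phi ->
  (forall y, psi (y + 1) = psi y) -> (forall y, phi (y + 1) = phi y) ->
  test_fun (fun p => psi p.1 * phi p.2).
Proof.
move=> [d [<- hd]] [e [<- he]] pd pe; split; first by move=> n; exact: Cn_tensor.
by move=> x y /=; rewrite pd pe.
Qed.

(** * Periodic sigmoids *)

Section sigmoid.
Variables (R : realType) (c k : R).

(* The product of sines is 1-periodic in [y], positive on (0, c) and negative on (c, 1),
   so [sig] approximates the indicator of (0, c) on the unit interval as [k] grows. *)
Definition sig (y : R) : R := (1 + expR (- (k * (sin (pi * y) * sin (pi * (c - y))))))^-1.

(* A syntactic algebra containing [sig] and closed under derivation: it provides the
   successive derivatives of [sig] all at once. *)
Inductive sexp := SCst of R | SSin | SCos | SSig | SAdd of sexp & sexp | SMul of sexp & sexp.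

Fixpoint seval (e : sexp) (y : R) : R :=
  match e with
  | SCst a => a
  | SSin => sin (pi * (c - y - y))
  | SCos => cos (pi * (c - y - y))
  | SSig => sig y
  | SAdd a b => seval a y + seval b y
  | SMul a b => seval a y * seval b y
  end.

Fixpoint sder (e : sexp) : sexp :=
  match e with
  | SCst _ => SCst 0
  | SSin => SMul (SCst (- (pi + pi))) SCos
  | SCos => SMul (SCst (pi + pi)) SSin
  | SSig => SMul (SMul (SCst (k * pi)) SSin) (SMul SSig (SAdd (SCst 1) (SMul (SCst (-1)) SSig)))
  | SAdd a b => SAdd (sder a) (sder b)
  | SMul a b => SAdd (SMul (sder a) b) (SMul a (sder b))
  end.

(** The logistic function solves [s' = s (1 - s)], so the derivative of [sig] is again a polynomial
    in [sig] and a sine; hence [sexp] is closed under [sder]. *)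
Lemma is_derive_sig (y : R) :
  is_derive y 1 sig (k * pi * sin (pi * (c - y - y)) * (sig y * (1 - sig y))).
Proof.
pose z (t : R) : R := k * (sin (pi * t) * sin (pi * (c - t))).
have dpi : is_derive y 1 (fun t : R => pi * t) (pi : R).
  by apply: is_derive_eq; rewrite /GRing.scale /=; ring.
have dpic : is_derive y 1 (fun t : R => pi * (c - t)) (- pi : R).
  by apply: is_derive_eq; rewrite /GRing.scale /=; ring.
have dz : is_derive y 1 (fun t => - z t) (- (k * pi * sin (pi * (c - y - y)))).
  have d1 : is_derive y 1 (fun t : R => sin (pi * t)) (cos (pi * y) * pi).
    exact: is_derive1_comp.
  have d2 : is_derive y 1 (fun t : R => sin (pi * (c - t))) (cos (pi * (c - y)) * - pi).
    exact: is_derive1_comp.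
  rewrite /z; apply: is_derive_eq.
  (* The subtraction formula for the sine merges the two terms of the product rule. *)
  have -> : pi * (c - y - y) = pi * (c - y) - pi * y by ring.
  by rewrite sinB /GRing.scale /=; ring.
have dE : is_derive y 1 (fun t => 1 + expR (- z t))
   (expR (- z y) * (- (k * pi * sin (pi * (c - y - y))))).
  have d1 : is_derive y 1 (fun t : R => expR (- z t))
     (expR (- z y) * (- (k * pi * sin (pi * (c - y - y))))) by exact: is_derive1_comp.
  by have := is_deriveD (is_derive_cst (1 : R) y (1 : R)) d1; rewrite add0r.
have pos : 0 < 1 + expR (- z y) by rewrite addr_gt0 ?expR_gt0.
have nz : 1 + expR (- z y) != 0 by rewrite gt_eqF.
have dI := @is_deriveV _ (fun t : R => 1 + expR (- z t)) y _ 1 nz dE.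
apply: (is_derive_eq dI).
rewrite /GRing.scale /= /sig -/(z y).
by field.
Qed.

Lemma is_derive_seval (e : sexp) (y : R) : is_derive y 1 (seval e) (seval (sder e) y).
Proof.
have dpi : is_derive y 1 (fun t : R => pi * (c - t - t)) (- (pi + pi) : R).
  by apply: is_derive_eq; rewrite /GRing.scale /=; ring.
elim: e => [a|||||] /=.
- exact: is_derive_cst.
- by have d := @is_derive1_comp _ (@sin R) _ y _ _ (is_derive_sin _) dpi;
    apply: (is_derive_eq d); rewrite mulrC.
- by have d := @is_derive1_comp _ (@cos R) _ y _ _ (is_derive_cos _) dpi;
    apply: (is_derive_eq d); ring.
- by have d := is_derive_sig y; apply: (is_derive_eq d); ring.
- by move=> a Ha b Hb; exact: is_deriveD.
- by move=> a Ha b Hb; apply: is_derive_eq; rewrite /GRing.scale /=; ring.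
Qed.

Lemma smooth_sig : smooth sig.
Proof.
exists (fun n => seval (iter n sder SSig)); split=> // n y.
by rewrite iterS; exact: is_derive_seval.
Qed.

(** Each of the two sines changes sign under a unit shift, so their product is invariant. *)
Lemma sig_periodic (y : R) : sig (y + 1) = sig y.
Proof.
rewrite /sig.
have -> : pi * (y + 1) = pi * y + pi :> R by ring.
have -> : pi * (c - (y + 1)) = pi * (c - y) - pi :> R by ring.
by rewrite sinDpi [sin (_ - pi)]sinB cospi sinpi mulr0 subr0 mulrN1 mulrNN.
Qed.

Lemma sig_ge0 (y : R) : 0 <= sig y.
Proof. by rewrite invr_ge0 addr_ge0 ?expR_ge0. Qed.

Lemma sig_le1 (y : R) : sig y <= 1.
Proof. by rewrite invf_le1 ?lerDl ?expR_ge0// addr_gt0 ?expR_gt0. Qed.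

Lemma continuous_sig : continuous sig.
Proof. by move=> y; exact: is_derive_continuous (is_derive_sig y). Qed.

End sigmoid.

(** * Primitives on the line and on segments *)

Section interval.
Variable R : realType.
Notation mu := (@lebesgue_measure R).

Lemma integrable_itvS (a b a' b' : R) (f : R -> R) : a <= a' -> b' <= b ->
  mu.-integrable `[a, b] (EFin \o f) -> mu.-integrable `[a', b'] (EFin \o f).
Proof. by move=> aa bb; apply: integrableS => //; exact: subset_itvScc. Qed.

Lemma continuous_itv_integrable (a b : R) (f : R -> R) : continuous f ->
  mu.-integrable `[a, b] (EFin \o f).
Proof.
move=> cf; apply: continuous_compact_integrable; first exact: segment_compact.
exact: continuous_subspaceT.
Qed.

Lemma Rintegral_itv_split (a b c : R) (f : R -> R) : a <= b -> b <= c ->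
  mu.-integrable `[a, c] (EFin \o f) ->
  \int[mu]_(t in `[a, c]) f t = \int[mu]_(t in `[a, b]) f t + \int[mu]_(t in `[b, c]) f t.
Proof.
move=> ab bc fi; apply/eqP; rewrite addrC -subr_eq; apply/eqP.
rewrite Rintegral_itvB ?bnd_simp// Rintegral_itv_obnd_cbnd//.
by apply: integrableS fi => //; apply: subset_itvr; rewrite bnd_simp.
Qed.

Lemma continuous_antiderivative (f : R -> R) : continuous f ->
  exists F : R -> R, forall y : R, is_derive y 1 F (f y).
Proof.
move=> cf.
(* The base point [- N] moves with [y] in order to stay below both [y] and 0; subtracting the
   integral up to 0 makes the value independent of [N], which is [FE]. *)
pose F (y : R) := let N := `|y| + 1 in
  \int[mu]_(t in `[- N, y]) f t - \int[mu]_(t in `[- N, 0]) f t.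
have FE N y : `|y| + 1 <= N ->
    F y = \int[mu]_(t in `[- N, y]) f t - \int[mu]_(t in `[- N, 0]) f t.
  move=> yN; rewrite /F /=.
  have y0 := normr_ge0 y; have yy := ler_norm y; have yny := lerNnormlW (lexx `|y|).
  have NN : - N <= - (`|y| + 1) by rewrite lerN2.
  have Ny : - (`|y| + 1) <= y by lra.
  have N0 : - (`|y| + 1) <= 0 by lra.
  rewrite (Rintegral_itv_split NN Ny (continuous_itv_integrable _ _ cf)).
  rewrite (Rintegral_itv_split NN N0 (continuous_itv_integrable _ _ cf)).
  ring.
exists F => y.
(* The extra unit lets one fixed [N] serve all points at distance less than 1 from [y]. *)
pose N := `|y| + 2.
have yN : - N < y by have := lerNnormlW (lexx `|y|); rewrite /N; lra.
have yu : y < y + 1 by rewrite ltrDl.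
have [d1 d2] := continuous_FTC1_closed yu (continuous_itv_integrable (- N) (y + 1) cf) yN (cf y).
have d : is_derive y 1 (fun y => \int[mu]_(t in `[- N, y]) f t) (f y).
  by apply: DeriveDef; [exact: d1|rewrite -derive1E; exact: d2].
apply: (@near_eq_is_derive _ _ _ (fun y => \int[mu]_(t in `[- N, y]) f t -
   \int[mu]_(t in `[- N, 0]) f t)); last first.
  by have := is_deriveB d (is_derive_cst (\int[mu]_(t in `[- N, 0]) f t) y (1 : R)); rewrite subr0.
near=> z; rewrite -FE//.
have : `|z - y| < 1 by rewrite distrC; near: z; exact: nbhsx_ballx.
by have := ler_normD (z - y) y; rewrite subrK /N; lra.
Unshelve. all: by end_near. Qed.

Lemma Rintegral_derivative (F f : R -> R) (a b : R) : continuous f ->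
  (forall y : R, is_derive y 1 F (f y)) -> a <= b ->
  \int[mu]_(t in `[a, b]) f t = F b - F a.
Proof.
move=> cf dF; rewrite le_eqVlt => /predU1P[->|ab].
  by rewrite set_itv1 Rintegral_set1 subrr.
have cF y : {for y, continuous F} by exact: is_derive_continuous (dF y).
rewrite /Rintegral (@continuous_FTC2 _ f F a b)//.
- exact: continuous_subspaceT.
- split; first by move=> x _; case: (dF x).
  + by apply: cvg_at_right_filter; exact: cF.
  + by apply: cvg_at_left_filter; exact: cF.
- by move=> x _; rewrite derive1E; case: (dF x).
Qed.

Lemma smooth_continuous (f : R -> R) : smooth f -> continuous f.
Proof. by move=> [d [<- hd]] y; exact: is_derive_continuous (hd 0%N y). Qed.

Lemma smooth_primitive (F f : R -> R) : smooth f ->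
  (forall y : R, is_derive y 1 F (f y)) -> smooth F.
Proof.
move=> [d [d0 hd]] dF; exists (fun n => if n is m.+1 then d m else F); split=> //.
by case=> [|n] y; [rewrite d0; exact: dF|exact: hd].
Qed.

Lemma smoothB_cst (f : R -> R) (a : R) : smooth f -> smooth (fun y => f y - a).
Proof.
move=> [d [d0 hd]].
exists (fun n y => if n is m.+1 then d n y else f y - a); split=> // -[|n] y /=.
  have := is_deriveB (hd 0%N y) (is_derive_cst a y (1 : R)).
  by rewrite subr0 d0.
exact: hd.
Qed.

(** Subtracting the mean is what makes the primitive periodic: its increment over a unit shift has
    zero derivative since [tau] is periodic, and this increment vanishes at 0. *)
Lemma periodic_primitive (tau : R -> R) : smooth tau ->
  (forall y, tau (y + 1) = tau y) ->
  exists Phi : R -> R, [/\ smooth Phi, forall y, Phi (y + 1) = Phi y &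
    forall y : R, is_derive y 1 Phi (tau y - \int[mu]_(t in `[0, 1]) tau t)].
Proof.
move=> stau ptau; have ctau := smooth_continuous stau.
have [F dF] := continuous_antiderivative ctau.
pose a := \int[mu]_(t in `[0, 1]) tau t.
have aE : a = F 1 - F 0 by exact: Rintegral_derivative.
pose Phi y := F y - a * y.
have dPhi (y : R) : is_derive y 1 Phi (tau y - a).
  have H := dF y; rewrite /Phi; apply: is_derive_eq.
  by rewrite /GRing.scale /=; ring.
exists Phi; split=> //; first exact: smooth_primitive (smoothB_cst _ stau) dPhi.
move=> y; pose D (t : R) := Phi (t + 1) - Phi t.
have : D y = D 0.
  apply: is_derive_0_is_cst => t; rewrite /D.
  have d1 : is_derive t 1 (fun t : R => t + 1) (1 + 0) by exact: is_deriveD.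
  have d2 := @is_derive1_comp _ Phi _ t _ _ (dPhi (t + 1)) d1.
  apply: (is_derive_eq (is_deriveB d2 (dPhi t))).
  by rewrite ptau; ring.
by rewrite /D /Phi add0r; have := aE; lra.
Qed.

End interval.

(** * Absolute continuity on lines *)

Lemma integrable_mul_bounded d (T : measurableType d) (R : realType)
    (mu : {measure set T -> \bar R}) (D : set T) (f h : T -> R) (M : R) :
  measurable D -> mu.-integrable D (EFin \o f) -> measurable_fun D h ->
  (forall x, D x -> `|h x| <= M) ->
  mu.-integrable D (EFin \o (fun x => f x * h x)).
Proof.
move=> mD fi mh hM.
apply: (@le_integrable _ _ _ _ _ _ _ (fun x => M%:E * (EFin \o f) x)%E) => //.
- apply/measurable_EFinP; apply: measurable_funM => //.
  by apply/measurable_EFinP; exact: measurable_int fi.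
- move=> x Dx /=; rewrite lee_fin !normrM mulrC ler_wpM2r//.
  by rewrite (le_trans (hM x Dx))// ler_norm.
- exact: integrableZl.
Qed.

#[global] Instance ae_lebesgue_filter (R : realType) :
  Filter (nbhs (almost_everywhere (@lebesgue_measure R))).
Proof. exact: ae_filter_ringOfSetsType. Qed.

(** * Functions orthogonal to all sigmoids *)

Section density.
Variable R : realType.
Notation mu := (@lebesgue_measure R).

Lemma ae_neq (a : R) : {ae mu, forall x, x != a}.
Proof.
exists [set a]; split=> //; first exact: lebesgue_measure_set1.
by move=> x /= /negP; rewrite negbK => /eqP.
Qed.

(** With [z] the product of sines, the distance equals the inverse of [1 + expR (k * |z|)] on either
    side of [c], and [expR x >= 1 + x] gives an explicit rate in [k]. *)
Lemma sig_dist_indic (c k y : R) : 0 <= k -> 0 < c < 1 -> 0 < y < 1 -> y != c ->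
  `|sig c k y - \1_(`[0, c]) y| <= (1 + k * `|sin (pi * y) * sin (pi * (c - y))|)^-1.
Proof.
move=> k0 c01 y01 yc; rewrite /sig; set z := sin _ * sin _.
have pi0 := pi_gt0 R.
have siny : 0 < sin (pi * y).
  by apply: sin_gt0_pi; rewrite mulr_gt0//=; [nra|lra].
have [cy|yc'] := ltP c y.
- have z0 : z < 0.
    rewrite /z pmulr_rlt0// -oppr_gt0 -sinN -mulrN.
    by apply: sin_gt0_pi; apply/andP; split; nra.
  rewrite indicE memNset ?subr0; last by rewrite /= in_itv /= => /andP[_]; lra.
  rewrite ger0_norm ?invr_ge0 ?addr_ge0 ?expR_ge0//.
  have kz : 0 <= k * `|z| by rewrite mulr_ge0.
  rewrite lef_pV2 ?posrE ?(ltr_pwDl ltr01)// ?expR_ge0//.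
  rewrite lerD2l (le_trans _ (expR_ge1Dx _))// ltr0_norm// mulrN lerDr//.
- have {}yc' : y < c by rewrite lt_neqAle yc.
  have z0 : 0 < z.
    rewrite /z mulr_gt0//.
    by apply: sin_gt0_pi; apply/andP; split; nra.
  rewrite indicE mem_set /=; last by rewrite in_itv /=; apply/andP; split; lra.
  have kz : 0 <= k * `|z| by rewrite mulr_ge0.
  have e0 : 0 < expR (k * z) := expR_gt0 _.
  have e1 : 1 + k * z <= expR (k * z) := expR_ge1Dx _.
  rewrite expRN gtr0_norm// in kz *.
  have -> : (1 + (expR (k * z))^-1)^-1 - 1 = - (1 + expR (k * z))^-1.
    by field; rewrite !gt_eqF ?addr_gt0.
  rewrite normrN ger0_norm ?invr_ge0; last by rewrite addr_ge0// ltW.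
  rewrite lef_pV2 ?posrE ?(ltr_pwDl ltr01)// ?expR_ge0//.
  by rewrite (le_trans e1)// lerDr.
Qed.

Lemma sig_cvg (c y : R) : 0 < c < 1 -> 0 < y < 1 -> y != c ->
  sig c n%:R y @[n --> \oo] --> (\1_(`[0, c]) y : R).
Proof.
move=> c01 y01 yc; apply/cvgrPdist_le => e e0.
set z := `|sin (pi * y) * sin (pi * (c - y))|.
have z0 : 0 < z.
  rewrite normr_gt0 mulf_neq0//.
    by rewrite gt_eqF// sin_gt0_pi//; have := pi_gt0 R; move=> ?; apply/andP; split; nra.
  have [cy|yc'] := ltP c y.
    rewrite -oppr_eq0 -sinN gt_eqF// sin_gt0_pi//.
    by have := pi_gt0 R; move=> ?; apply/andP; split; nra.
  have {}yc' : y < c by rewrite lt_neqAle yc.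
  by rewrite gt_eqF// sin_gt0_pi//; have := pi_gt0 R; move=> ?; apply/andP; split; nra.
near=> n; rewrite distrC (le_trans (sig_dist_indic _ c01 y01 yc))// -/z.
have n0 : 0 <= (n%:R : R) by [].
rewrite -[leRHS]invrK lef_pV2 ?posrE ?invr_gt0//; last by rewrite ltr_pwDl// mulr_ge0// ltW.
suff : e^-1 / z <= n%:R by rewrite ler_pdivrMr//; lra.
by near: n; exact: nbhs_infty_ger.
Unshelve. all: by end_near. Qed.

Lemma integrable_mul_sig (h : R -> R) (c k : R) : mu.-integrable `[0, 1] (EFin \o h) ->
  mu.-integrable `[0, 1] (EFin \o (fun y => h y * sig c k y)).
Proof.
move=> hi; have msig : measurable_fun `[(0 : R), 1] (sig c k).
  by apply: measurable_funTS; apply: continuous_measurable_fun; exact: continuous_sig.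
apply: (@integrable_mul_bounded _ _ R mu _ h (sig c k) 1 (measurable_itv _) hi msig) => y _.
by rewrite ger0_norm ?sig_ge0// sig_le1.
Qed.

(** Dominated convergence with bound [|h|]: as the steepness grows, the sigmoids converge to the
    indicator of [[0, c]] away from the three points 0, [c] and 1. *)
Lemma Rintegral0_initial (h : R -> R) (c : R) : mu.-integrable `[(0 : R), 1] (EFin \o h) ->
  0 < c < 1 ->
  (forall n, \int[mu]_(y in `[(0 : R), 1]) (h y * sig c n%:R y) = 0) ->
  \int[mu]_(y in `[(0 : R), c]) h y = 0.
Proof.
move=> hi c01 h0.
have mh : measurable_fun `[(0 : R), 1] h by apply/measurable_EFinP; exact: measurable_int hi.
have msig n : measurable_fun `[(0 : R), 1] (sig c n).
  by apply: measurable_funTS; apply: continuous_measurable_fun; exact: continuous_sig.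
have mind : measurable_fun `[(0 : R), 1] (\1_(`[(0 : R), c]) : R -> R) by exact: measurable_indic.
have ae1 : {ae mu, forall y, `[(0 : R), 1]%classic y ->
    (h y * sig c n%:R y)%:E @[n --> \oo] --> (h y * \1_(`[(0 : R), c]) y)%:E}.
  have := ae_neq 0; have := ae_neq 1; have := ae_neq c.
  apply: filterS3 => y yc y1 y0 /=; rewrite in_itv /= => /andP[yge0 yle1].
  apply: cvg_EFin; first exact: nearW.
  apply: cvgM; first exact: cvg_cst.
  by apply: sig_cvg => //; rewrite lt_neqAle eq_sym y0 yge0 lt_neqAle y1.
have dom : {ae mu, forall y n, `[(0 : R), 1]%classic y ->
    (`|(h y * sig c n%:R y)%:E| <= `|h y|%:E)%E}.
  apply: aeW => y n _ /=; rewrite lee_fin normrM ler_piMr//.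
  by rewrite ger0_norm ?sig_ge0// sig_le1.
have [_ _] := @dominated_convergence _ _ R mu _ (measurable_itv _)
  (fun n y => (h y * sig c n%:R y)%:E) (fun y => (h y * \1_(`[(0 : R), c]) y)%:E) _
  (fun n => (measurable_EFinP _ _).2 (measurable_funM mh (msig n%:R)))
  ((measurable_EFinP _ _).2 (measurable_funM mh mind)) ae1 (integrable_norm hi) dom.
rewrite (_ : [sequence _]_n = cst 0%E); last first.
  apply/funext => n /=; have := h0 n; rewrite /Rintegral.
  (* A real integral is the [fine] part, which is 0 also for infinite values; finiteness makes the
     extended integral vanish too. *)
  have fin : (\int[mu]_(y in `[0%R, 1%R]) (h y * sig c n%:R y)%:E)%E \is a fin_num.
    apply: integrable_fin_num => //.
    exact: integrable_mul_sig.
  by move=> e; rewrite -(fineK fin) e.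
move/(cvg_unique (@ereal_hausdorff R) (cvg_cst _)) => e.
have sub : (`[(0 : R), c] `<=` `[(0 : R), 1])%classic by apply: subset_itvl; rewrite bnd_simp; lra.
rewrite -(setIidl sub) Rintegral_mkcondl /Rintegral.
rewrite [X in fine X](_ : _ = 0%E)// e.
apply: eq_integral => y _; rewrite patchE indicE.
by case: ifPn => _; rewrite ?mulr1 ?mulr0.
Qed.

(** The primitive of [h] is continuous, so its zeros at the rational points spread to the whole open
    interval. Testing rational end points only keeps the family of tests countable. *)
Lemma interior_integral0 (h : R -> R) : mu.-integrable `[(0 : R), 1] (EFin \o h) ->
  (forall q : rat, 0 < (ratr q : R) < 1 -> \int[mu]_(y in `[(0 : R), ratr q]) h y = 0) ->
  forall x, 0 < x < 1 -> \int[mu]_(y in `[(0 : R), x]) h y = 0.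
Proof.
move=> hi h0 x x01.
have [+ _ _] := (continuous_within_itvP _ ltr01).1 (parameterized_integral_continuous ler01 hi).
have xin : x \in `](0 : R), 1[ by rewrite in_itv.
move=> /(_ x xin) cx; apply: contrapT => /eqP nz.
have : \forall t \near x, parameterized_integral mu 0 t h != 0 by exact: cvgr_neq0 cx nz.
have : \forall t \near x, t \in `](0 : R), 1[ by exact: near_in_itvoo.
move=> near1 near2; have [e /= e0 He] := filterI near1 near2.
have /rat_in_itvoo[q /itvP qx] : x < x + e by rewrite ltrDl.
have [] := He (ratr q).
  by rewrite /ball_ /= distrC gtr0_norm ?subr_gt0 ?qx// ltrBlDl qx.
rewrite in_itv /= => q01; apply/negP; rewrite negbK; apply/eqP; exact: h0.
Qed.

(** Lebesgue differentiation: almost everywhere [h] is the derivative of its primitive, which is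
    locally zero. The extension [h'] by zero makes the theorem applicable on the whole line. *)
Lemma ae_eq0_integral_initial (h : R -> R) : mu.-integrable `[(0 : R), 1] (EFin \o h) ->
  (forall x, 0 < x < 1 -> \int[mu]_(y in `[(0 : R), x]) h y = 0) ->
  {ae mu, forall x, `[(0 : R), 1]%classic x -> h x = 0}.
Proof.
move=> hi h0; pose h' := h \_ `[(0 : R), 1].
have h'i : mu.-integrable setT (EFin \o h').
  by rewrite /h' -restrict_EFin; apply/integrable_restrict => //=; rewrite setTI.
have h'i0 (y : R) : mu.-integrable [set` Interval (BLeft 0) (BRight y)] (EFin \o h').
  by apply: integrableS h'i.
have := @FTC1 R h' (BLeft 0) h'i0 (open_integrable_locally openT h'i).
have := ae_neq 0; have := ae_neq 1.
apply: filterS3 => x x1 x0 /= H; rewrite in_itv /= => /andP[xge0 xle1].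
have x01 : 0 < x < 1 by rewrite lt_neqAle eq_sym x0 xge0 lt_neqAle x1.
have [|_] := H; first by rewrite lte_fin; lra.
have -> : h' x = h x by rewrite /h' patchE mem_set//= in_itv /= xge0.
move=> <-; rewrite derive1E.
rewrite (@near_eq_derive _ _ _ _ (cst 0)) ?derive_cst//.
have : \forall t \near x, t \in `](0 : R), 1[ by apply: near_in_itvoo; rewrite in_itv.
apply: filterS => t; rewrite in_itv /= => t01; rewrite -[RHS](h0 t t01).
apply: eq_Rintegral => y; rewrite inE /= in_itv /= => yt.
by rewrite /h' patchE mem_set//= in_itv /=; lra.
Qed.

(** A countable family of tests suffices. Countability matters later, when each test holds only
    outside its own null set of lines. *)
Lemma ae_eq0_sig (h : R -> R) : mu.-integrable `[(0 : R), 1] (EFin \o h) ->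
  (forall (q : rat) n, 0 < (ratr q : R) < 1 ->
     \int[mu]_(y in `[(0 : R), 1]) (h y * sig (ratr q) n%:R y) = 0) ->
  {ae mu, forall x, `[(0 : R), 1]%classic x -> h x = 0}.
Proof.
move=> hi h0; apply: ae_eq0_integral_initial => //.
apply: interior_integral0 => // q q01.
by apply: Rintegral0_initial => // n; exact: h0.
Qed.

End density.

Lemma EFin_Rintegral d (T : measurableType d) (R : realType)
    (mu : {measure set T -> \bar R}) (D : set T) (f : T -> R) :
  measurable D -> mu.-integrable D (EFin \o f) ->
  (\int[mu]_(x in D) (f x)%:E)%E = (\int[mu]_(x in D) f x)%:E.
Proof. by move=> mD fi; rewrite /Rintegral fineK//; exact: integrable_fin_num. Qed.

Lemma ae_eq_Rintegral d (T : measurableType d) (R : realType)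
    (mu : {measure set T -> \bar R}) (D : set T) (f g : T -> R) :
  measurable D -> measurable_fun D f -> measurable_fun D g ->
  {ae mu, forall x, D x -> f x = g x} ->
  \int[mu]_(x in D) f x = \int[mu]_(x in D) g x.
Proof.
move=> mD mf mg fg; congr fine; apply: ae_eq_integral => //; try exact/measurable_EFinP.
apply: (@filterS _ _ (ae_filter_ringOfSetsType mu) _ _ _ fg) => x H Dx.
by rewrite H.
Qed.

Section integrable_real.
Context d (T : measurableType d) (R : realType) (mu : {measure set T -> \bar R}).
Variables (D : set T) (mD : measurable D).

Lemma integrable_realZ (a : R) (f : T -> R) : mu.-integrable D (EFin \o f) ->
  mu.-integrable D (EFin \o (fun x => a * f x)).
Proof. by move=> fi; have := integrableZl mD a fi. Qed.

Lemma integrable_realD (f g : T -> R) : mu.-integrable D (EFin \o f) ->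
  mu.-integrable D (EFin \o g) -> mu.-integrable D (EFin \o (fun x => f x + g x)).
Proof. by move=> fi gi; have := integrableD mD fi gi. Qed.

Lemma integrable_realB (f g : T -> R) : mu.-integrable D (EFin \o f) ->
  mu.-integrable D (EFin \o g) -> mu.-integrable D (EFin \o (fun x => f x - g x)).
Proof. by move=> fi gi; have := integrableB mD fi gi. Qed.

End integrable_real.

Lemma integrable_tensor d1 d2 (T1 : measurableType d1) (T2 : measurableType d2) (R : realType)
    (m1 : {sigma_finite_measure set T1 -> \bar R}) (m2 : {sigma_finite_measure set T2 -> \bar R})
    (f : T1 -> R) (g : T2 -> R) (h : T1 * T2 -> R) :
  m1.-integrable setT (EFin \o f) -> m2.-integrable setT (EFin \o g) ->
  measurable_fun setT h -> (forall p, `|h p| <= 1) ->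
  (m1 \x m2)%E.-integrable setT (EFin \o (fun p => f p.1 * g p.2 * h p)).
Proof.
move=> fi gi mh h1; set k := fun p => _.
have mf : measurable_fun setT f by apply/measurable_EFinP; exact: measurable_int fi.
have mg : measurable_fun setT g by apply/measurable_EFinP; exact: measurable_int gi.
have mk : measurable_fun setT (EFin \o k).
  apply/measurable_EFinP; apply: measurable_funM => //.
  by apply: measurable_funM; apply: measurableT_comp.
apply/integrable12ltyP => //.
have C : (\int[m2]_t `|(EFin \o g) t| < +oo)%E by have /integrableP[] := gi.
have mF : measurable_fun setT (fun x => \int[m2]_y `|(EFin \o k) (x, y)|)%E.
  by apply: (measurable_fun_fubini_tonelli_F (abse \o (EFin \o k))) => //=; exact: measurableT_comp.
have maf : measurable_fun setT (fun x => `|(EFin \o f) x|)%E.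
  by apply: measurableT_comp => //; exact/measurable_EFinP.
have mag : measurable_fun setT (fun x => `|(EFin \o g) x|)%E.
  by apply: measurableT_comp => //; exact/measurable_EFinP.
apply: (@le_lt_trans _ _ (\int[m1]_y (`|(EFin \o f) y| * \int[m2]_t `|(EFin \o g) t|))%E).
  apply: ge0_le_integral => //.
  - by move=> y _; exact: integral_ge0.
  - by apply: emeasurable_funM.
  - move=> y _; rewrite -ge0_integralZl//.
    apply: ge0_le_integral => //.
    + by apply: measurableT_comp => //; apply: measurableT_comp.
    + by apply: emeasurable_funM.
    + by move=> t _ /=; rewrite lee_fin /k normrM normrM ler_piMr.
rewrite ge0_integralZr//; last exact: integral_ge0.
apply: lte_mul_pinfty => //; first exact: integral_ge0.
by rewrite ge0_fin_numE; [by have /integrableP[] := fi | exact: integral_ge0].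
Qed.

Lemma integralT_scaled_restrict d (T : measurableType d) (R : realType)
    (mu : {measure set T -> \bar R}) (D : set T) (f phi : T -> R) (c : R) :
  measurable D -> mu.-integrable D (EFin \o f) -> (forall t, phi t = c * (f \_ D) t) ->
  (\int[mu]_t (phi t)%:E)%E = (c * \int[mu]_(t in D) f t)%:E.
Proof.
move=> mD fi phiE; rewrite EFinM -EFin_Rintegral// -integralZl//.
rewrite [RHS]integral_mkcond; apply: eq_integral => t _.
by rewrite phiE !patchE; case: ifPn => // _; rewrite mulr0.
Qed.

(** * Integration by parts and the du Bois-Reymond lemma *)

Section by_parts.
Variable R : realType.
Notation mu := (@lebesgue_measure R).
Local Notation I := (`[(0 : R), 1]%classic).

Lemma measurable_le_pair : measurable [set p : R * R | p.2 <= p.1].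
Proof.
have -> : [set p : R * R | p.2 <= p.1] = (fun p : R * R => p.2 - p.1) @^-1` `]-oo, 0].
  by apply/seteqP; split => p /=; rewrite in_itv /= subr_le0.
rewrite -[X in measurable X]setTI.
have : measurable_fun setT (fun p : R * R => p.2 - p.1) by exact: measurable_funB.
exact.
Qed.

Lemma integrable_primitive (g : R -> R) : mu.-integrable I (EFin \o g) ->
  mu.-integrable I (EFin \o (fun t => \int[mu]_(y in `[0, t]) g y)).
Proof.
move=> gi; apply: continuous_compact_integrable; first exact: segment_compact.
exact: parameterized_integral_continuous.
Qed.

Lemma bounded_on_segment (h : R -> R) : continuous h ->
  exists M : R, forall t, I t -> `|h t| <= M.
Proof.
move=> ch.
have cn : {within I, continuous (fun t => `|h t|)}.
  by apply: continuous_subspaceT => t; apply: cvg_norm; exact: ch.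
by have [c _ cmax] := EVT_max ler01 cn; exists `|h c| => t It; exact: cmax.
Qed.

Lemma integrable_mul_continuous (f h : R -> R) : mu.-integrable I (EFin \o f) ->
  continuous h -> mu.-integrable I (EFin \o (fun t => f t * h t)).
Proof.
move=> fi ch; have [M hM] := bounded_on_segment ch.
have mh : measurable_fun I h by apply: measurable_funTS; exact: continuous_measurable_fun.
exact: (@integrable_mul_bounded _ _ R mu _ f h M (measurable_itv _) fi mh).
Qed.

(** Fubini for [g y * rho t] on the triangle [t <= y], which asks no more of [g] than integrability.
    The zero mean of [g] removes the boundary terms. *)
Lemma Rintegral_by_parts (g Phi rho : R -> R) :
  mu.-integrable I (EFin \o g) -> \int[mu]_(y in I) g y = 0 ->
  continuous rho -> (forall y : R, is_derive y 1 Phi (rho y)) ->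
  \int[mu]_(y in I) (g y * Phi y) = - \int[mu]_(t in I) ((\int[mu]_(y in `[0, t]) g y) * rho t).
Proof.
move=> gi g0 crho dPhi.
have ri a b : mu.-integrable `[a, b] (EFin \o rho) by exact: continuous_itv_integrable.
have cPhi : continuous Phi by move=> y; exact: is_derive_continuous (dPhi y).
pose g' := g \_ I; pose r' := rho \_ I.
have g'i : mu.-integrable setT (EFin \o g').
  by rewrite /g' -restrict_EFin; apply/integrable_restrict => //=; rewrite setTI.
have r'i : mu.-integrable setT (EFin \o r').
  by rewrite /r' -restrict_EFin; apply/integrable_restrict => //=; rewrite setTI.
have mg' : measurable_fun setT g' by apply/measurable_EFinP; exact: measurable_int g'i.
have mr' : measurable_fun setT r' by apply/measurable_EFinP; exact: measurable_int r'i.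
pose k (p : R * R) := g' p.1 * r' p.2 * \1_[set p : R * R | p.2 <= p.1] p.
have ki : (mu \x mu)%E.-integrable setT (EFin \o k).
  apply: (integrable_tensor g'i r'i) => [|p].
    by apply: measurable_indic; exact: measurable_le_pair.
  by rewrite indicE; case: (_ \in _); rewrite ?normr1 ?normr0.
have Fub := Fubini ki.
(* Integrating in [t] first: [rho] over [[0, y]] gives the increment of [Phi]. *)
have kL y : (\int[mu]_t (EFin \o k) (y, t))%E = (((fun y => g y * (Phi y - Phi 0)) \_ I) y)%:E.
  rewrite patchE; case: ifPn => yI; last first.
    rewrite (_ : (fun t => _) = cst 0%E) ?integral0//; apply/funext => t /=.
    by rewrite /k /g' patchE (negbTE yI) !mul0r.
  have y01 : 0 <= y <= 1 by move: yI; rewrite inE /= in_itv.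
  have y0 : 0 <= y by case/andP: y01.
  rewrite -(@Rintegral_derivative R Phi rho 0 y crho dPhi y0).
  apply: integralT_scaled_restrict => //= t; rewrite /k /g' /r' !patchE yI -mulrA; congr (_ * _).
  rewrite indicE; case: ifPn => tI; case: ifPn => ty; rewrite ?mul0r ?mulr1; last by [].
  - move: ty; rewrite inE /= in_itv /= => /andP[t0 ty].
    by rewrite mem_set// mulr1.
  - rewrite memNset ?mulr0//= => ty'; case/negP: ty; rewrite inE /= in_itv /=.
    by move: tI; rewrite inE /= in_itv /= => /andP[-> _].
  - case/negP: tI; move: ty; rewrite !inE /= !in_itv /= => /andP[-> ty] /=.
    by rewrite (le_trans ty)//; case/andP: y01.
have kR t : (\int[mu]_y (EFin \o k) (y, t))%E =
    (((fun t => - ((\int[mu]_(y in `[0, t]) g y) * rho t)) \_ I) t)%:E.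
  rewrite patchE; case: ifPn => tI; last first.
    rewrite (_ : (fun y => _) = cst 0%E) ?integral0//; apply/funext => y /=.
    by rewrite /k /r' patchE (negbTE tI) mulr0 mul0r.
  have t01 : 0 <= t <= 1 by move: tI; rewrite inE /= in_itv.
  have /andP[t0 t1] := t01.
  have gti : mu.-integrable `[t, 1] (EFin \o g) by apply: integrable_itvS gi.
  (* Integrating in [y] first leaves [g] over [[t, 1]]; by the zero mean this is minus its integral
     over [[0, t]]. *)
  have -> : - (\int[mu]_(y in `[0, t]) g y * rho t) = rho t * \int[mu]_(y in `[t, 1]) g y.
    by move: g0; rewrite (Rintegral_itv_split t0 t1 gi) => /eqP; rewrite addr_eq0 => /eqP ->; ring.
  apply: integralT_scaled_restrict => //= y; rewrite /k /g' /r' !patchE tI [_ * rho t]mulrC -mulrA; congr (_ * _).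
  rewrite indicE; case: ifPn => yI; case: ifPn => ty; rewrite ?mul0r ?mulr1; last by [].
  - move: ty; rewrite inE /= in_itv /= => /andP[ty y1].
    by rewrite mem_set// mulr1.
  - rewrite memNset ?mulr0//= => ty'; case/negP: ty; rewrite inE /= in_itv /= ty'.
    by move: yI; rewrite inE /= in_itv /= => /andP[_ ->].
  - case/negP: yI; move: ty; rewrite !inE /= !in_itv /= => /andP[ty ->].
    by rewrite (le_trans t0).
have main : \int[mu]_(y in I) (g y * (Phi y - Phi 0)) =
    \int[mu]_(t in I) (- ((\int[mu]_(y in `[0, t]) g y) * rho t)).
  rewrite Rintegral_mkcond [RHS]Rintegral_mkcond; congr fine.
  transitivity (\int[mu]_y \int[mu]_t (EFin \o k) (y, t))%E.
    by apply: eq_integral => y _; exact/esym/kL.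
  by rewrite Fub; apply: eq_integral => t _; exact: kR.
have Gri : mu.-integrable I (EFin \o (fun t => (\int[mu]_(y in `[0, t]) g y) * rho t)).
  by apply: integrable_mul_continuous => //; exact: integrable_primitive.
have gPi : mu.-integrable I (EFin \o (fun y => g y * Phi y)) by exact: integrable_mul_continuous.
have gP0i : mu.-integrable I (EFin \o (fun y => Phi 0 * g y)) by exact: integrable_realZ.
have eL : \int[mu]_(y in I) (g y * (Phi y - Phi 0)) = \int[mu]_(y in I) (g y * Phi y).
  under eq_Rintegral do rewrite mulrBr [_ * Phi 0]mulrC.
  by rewrite RintegralB// RintegralZl// g0 mulr0 subr0.
rewrite -eL main; under eq_Rintegral do rewrite -mulN1r.
by rewrite RintegralZl// mulN1r.
Qed.

(* After integration by parts, [f] minus the primitive of [g] is orthogonal to every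
   centred sigmoid, hence constant. *)
Lemma du_Bois_Reymond (f g : R -> R) (Phi : rat -> nat -> R -> R) :
  mu.-integrable I (EFin \o f) -> mu.-integrable I (EFin \o g) ->
  \int[mu]_(y in I) g y = 0 ->
  (forall q n (y : R), is_derive y 1 (Phi q n)
     (sig (ratr q) n%:R y - \int[mu]_(t in I) sig (ratr q) n%:R t)) ->
  (forall q n, \int[mu]_(y in I)
     (f y * (sig (ratr q) n%:R y - \int[mu]_(t in I) sig (ratr q) n%:R t) + g y * Phi q n y) = 0) ->
  exists kappa : R, {ae mu, forall y, I y -> f y = kappa + \int[mu]_(t in `[0, y]) g t}.
Proof.
move=> fi gi g0 dPhi weak.
pose G t := \int[mu]_(y in `[0, t]) g y.
have Gi : mu.-integrable I (EFin \o G) by exact: integrable_primitive.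
have fGi : mu.-integrable I (EFin \o (fun y => f y - G y)) by exact: integrable_realB.
(* Centred tests determine [f - G] up to a constant, which must then be its mean. *)
pose kappa := \int[mu]_(y in I) (f y - G y).
have kc : mu.-integrable I (EFin \o cst kappa).
  by apply: continuous_itv_integrable; exact: cst_continuous.
exists kappa.
have : {ae mu, forall y, I y -> f y - G y - kappa = 0}.
  apply: ae_eq0_sig.
    by have := @integrable_realB _ _ R mu I (measurable_itv _) _ _ fGi kc.
  move=> q n _; pose s := sig (R := R) (ratr q) n%:R.
  have cs : continuous s by exact: continuous_sig.
  pose m := \int[mu]_(t in I) s t.
  have csm : continuous (fun y => s y - m).
    by move=> y; apply: cvgB; [exact: cs|exact: cvg_cst].
  have cPhi : continuous (Phi q n) by move=> y; exact: is_derive_continuous (dPhi q n y).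
  have := weak q n; rewrite -/s -/m.
  rewrite RintegralD//; [|exact: integrable_mul_continuous..].
  rewrite (Rintegral_by_parts gi g0 csm (dPhi q n)) -/s -/m.
  rewrite -RintegralB//; [|exact: integrable_mul_continuous..].
  rewrite (_ : \int[mu]_(x in I) _ = \int[mu]_(x in I) ((f x - G x) * s x - m * (f x - G x))); last first.
    by apply: eq_Rintegral => y _; rewrite -/(G y); ring.
  rewrite RintegralB//; [|exact: integrable_mul_continuous|exact: integrable_realZ].
  rewrite RintegralZl// -/kappa => e.
  (* The centring moves from the test to the function: integrating [(f - G) (s - m)] is the same as
     integrating [(f - G - kappa) s]. *)
  rewrite (_ : \int[mu]_(x in I) _ = \int[mu]_(x in I) ((f x - G x) * s x - kappa * s x)); last first.
    by apply: eq_Rintegral => y _; ring.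
  have si : mu.-integrable I (EFin \o s) by exact: continuous_itv_integrable.
  rewrite RintegralB//; [|exact: integrable_mul_continuous|exact: integrable_realZ].
  by rewrite RintegralZl// -/m [kappa * m]mulrC.
apply: filterS => y H Iy; have := H Iy; rewrite -/(G y); lra.
Qed.

End by_parts.

(** * Tonelli and Fubini on product sets *)

Section product_sets.
Context d1 d2 (T1 : measurableType d1) (T2 : measurableType d2) (R : realType).
Variables (m1 : {sigma_finite_measure set T1 -> \bar R}).
Variables (m2 : {sigma_finite_measure set T2 -> \bar R}).
Variables (D1 : set T1) (D2 : set T2) (mD1 : measurable D1) (mD2 : measurable D2).
Local Open Scope ereal_scope.

Lemma patch_setX (f : T1 * T2 -> \bar R) x :
  (fun y => (f \_ (D1 `*` D2)) (x, y)) =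
  if x \in D1 then (fun y => f (x, y)) \_ D2 else cst 0.
Proof.
apply/funext => y; rewrite patchE; case: (boolP (x \in D1)) => xD.
  rewrite patchE; case: (boolP (y \in D2)) => yD.
    by rewrite mem_set//; split=> /=; exact/set_mem.
  by rewrite memNset// => -[_ /=] /mem_set; exact/negP.
by rewrite memNset// => -[/= /mem_set]; rewrite (negbTE xD).
Qed.

Lemma integral_patch_setX (f : T1 * T2 -> \bar R) :
  (fun x => \int[m2]_y (f \_ (D1 `*` D2)) (x, y)) =
  (fun x => \int[m2]_(y in D2) f (x, y)) \_ D1.
Proof.
apply/funext => x; rewrite patch_setX patchE; case: ifPn => // _.
  by rewrite -integral_mkcond.
by rewrite integral0.
Qed.

Lemma measurable_integral_setX (f : T1 * T2 -> \bar R) : measurable_fun setT f ->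
  (forall p, 0 <= f p) -> measurable_fun D1 (fun x => \int[m2]_(y in D2) f (x, y)).
Proof.
move=> mf f0.
have mX : measurable (D1 `*` D2) by exact: measurableX.
have : measurable_fun setT (fun x => \int[m2]_y (f \_ (D1 `*` D2)) (x, y)).
  apply: (measurable_fun_fubini_tonelli_F (f \_ (D1 `*` D2))).
    by apply/(measurable_restrictT _ mX); exact: measurable_funTS.
  by move=> p; rewrite patchE; case: ifPn.
by rewrite integral_patch_setX => /(measurable_restrictT _ mD1).
Qed.

Lemma tonelli_setX (f : T1 * T2 -> \bar R) : measurable_fun setT f ->
  (forall p, 0 <= f p) ->
  \int[m1 \x m2]_(p in D1 `*` D2) f p = \int[m1]_(x in D1) \int[m2]_(y in D2) f (x, y).
Proof.
move=> mf f0; have mX : measurable (D1 `*` D2) by exact: measurableX.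
rewrite integral_mkcond fubini_tonelli1; first last.
- by move=> p; rewrite patchE; case: ifPn.
- by apply/(measurable_restrictT _ mX); exact: measurable_funTS.
by rewrite /fubini_F integral_patch_setX -integral_mkcond.
Qed.

(** The inner integral is taken in [R]. It agrees with the extended one on almost every line, namely
    where the slice is integrable, and this suffices for the outer integral. *)
Lemma fubini_setX (f : T1 * T2 -> R) :
  (m1 \x m2).-integrable (D1 `*` D2) (EFin \o f) ->
  [/\ {ae m1, forall x, D1 x -> m2.-integrable D2 (EFin \o (fun y => f (x, y)))},
      m1.-integrable D1 (EFin \o (fun x => \int[m2]_(y in D2) f (x, y))%R) &
      \int[m1 \x m2]_(p in D1 `*` D2) (f p)%:E =
      \int[m1]_(x in D1) (\int[m2]_(y in D2) f (x, y))%R%:E].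
Proof.
have mX : measurable (D1 `*` D2) by exact: measurableX.
move=> /(integrable_mkcond _ mX) fi.
have ae1 : {ae m1, forall x, D1 x -> m2.-integrable D2 (EFin \o (fun y => f (x, y)))}.
  apply: (@filterS _ _ (ae_filter_ringOfSetsType m1) _ _ _ (ae_integrable1 fi)) => x.
  rewrite (patch_setX (EFin \o f)) => + Dx; rewrite mem_set//.
  by move/(integrable_mkcond _ mD2).
have Fi := integrable_fubini_F fi.
rewrite /fubini_F integral_patch_setX in Fi.
have {}Fi := (integrable_mkcond _ mD1).2 Fi.
have finF : {ae m1, forall x, D1 x ->
    \int[m2]_(y in D2) (EFin \o f) (x, y) = (\int[m2]_(y in D2) f (x, y))%R%:E}.
  apply: (@filterS _ _ (ae_filter_ringOfSetsType m1) _ _ _ ae1) => x H Dx.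
  exact: EFin_Rintegral (H Dx).
have mF := measurable_int _ Fi.
have mR : measurable_fun D1 (EFin \o (fun x => \int[m2]_(y in D2) f (x, y))%R).
  apply/measurable_EFinP.
  exact: (measurableT_comp (fine_measurable measurableT) mF).
have FE : \int[m1]_(x in D1) \int[m2]_(y in D2) (EFin \o f) (x, y) =
    \int[m1]_(x in D1) (\int[m2]_(y in D2) f (x, y))%R%:E by exact: ae_eq_integral.
split=> //.
- apply/integrableP; split=> //; have /integrableP[_] := Fi.
  rewrite (ae_eq_integral (abse \o (EFin \o (fun x => \int[m2]_(y in D2) f (x, y))%R)))//.
  + exact: measurableT_comp.
  + exact: measurableT_comp.
  + apply: (@filterS _ _ (ae_filter_ringOfSetsType m1) _ _ _ finF) => x H Dx /=.
    by rewrite H.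
- rewrite -FE integral_mkcond -(integral12_prod_meas1 fi).
  by rewrite /fubini_F integral_patch_setX -integral_mkcond.
Qed.

(** The form in which an estimate on almost every line becomes an estimate on the square. *)
Lemma le_integral_setX (f g : T1 * T2 -> \bar R) :
  measurable_fun setT f -> measurable_fun setT g ->
  (forall p, 0 <= f p) -> (forall p, 0 <= g p) ->
  {ae m1, forall x, D1 x -> \int[m2]_(y in D2) f (x, y) <= \int[m2]_(y in D2) g (x, y)} ->
  \int[m1 \x m2]_(p in D1 `*` D2) f p <= \int[m1 \x m2]_(p in D1 `*` D2) g p.
Proof.
move=> mf mg f0 g0 fg; rewrite !tonelli_setX//.
apply: ae_ge0_le_integral => //.
- by move=> x _; exact: integral_ge0.
- exact: measurable_integral_setX.
- by move=> x _; exact: integral_ge0.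
- exact: measurable_integral_setX.
Qed.

End product_sets.

(** * From weak derivatives on the cell to almost every vertical line *)

Section cell.
Variable R : realType.
Notation mu := (@lebesgue_measure R).
Local Notation I := (`[(0 : R), 1]%classic).
Local Open Scope ereal_scope.

(* [lebesgue_measure] lives on this type; the measurable structure inferred for [R] itself
   is convertible to it but not unifiable with it. *)
Local Notation RR := (measurableTypeR R).

(** Primitives live on closed segments, so the half-open cell is exchanged for the closed square;
    after Tonelli the end points are added one variable at a time. *)
Lemma integral_cell_closed (f : RR * RR -> \bar R) : measurable_fun setT f ->
  (forall p, 0 <= f p) ->
  \int[@leb2 R]_(p in @cell R) f p = \int[mu \x mu]_(p in I `*` I) f p.
Proof.
move=> mf f0.
have J : measurable (`[0%R, 1%R[%classic : set RR) by exact: measurable_itv.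
have mI : measurable (I : set RR) by exact: measurable_itv.
have e1 := @tonelli_setX _ _ RR RR R mu mu _ _ J J f mf f0.
have e2 := @tonelli_setX _ _ RR RR R mu mu _ _ mI mI f mf f0.
apply: (etrans e1); apply: (etrans _ (esym e2)).
have mF := @measurable_integral_setX _ _ RR RR R mu _ _ mI mI f mf f0.
rewrite -integral_itv_bndo_bndc; last first.
  by apply: measurable_funS mF => //; apply: subset_itvl; rewrite bnd_simp.
apply: eq_integral => x _; apply: integral_itv_bndo_bndc.
by apply: measurable_funTS; apply: measurableT_comp.
Qed.

Lemma integrable_cell_closed (f : RR * RR -> R) : measurable_fun setT f ->
  \int[@leb2 R]_(p in @cell R) `|f p|%:E < +oo ->
  (mu \x mu).-integrable (I `*` I) (EFin \o f).
Proof.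
move=> mf fi; have mf' : measurable_fun setT (EFin \o f) by exact/measurable_EFinP.
apply/integrableP; split; first exact: measurable_funTS.
rewrite -integral_cell_closed//; exact: measurableT_comp.
Qed.

Lemma integral_cell_closed_real (f : RR * RR -> R) : measurable_fun setT f ->
  \int[@leb2 R]_(p in @cell R) (f p)%:E = \int[mu \x mu]_(p in I `*` I) (f p)%:E.
Proof.
move=> mf; have mf' : measurable_fun setT (EFin \o f) by exact/measurable_EFinP.
rewrite integralE [RHS]integralE; congr (_ - _); apply: integral_cell_closed => //.
- exact: measurable_funepos.
- exact: measurable_funeneg.
Qed.

Lemma leb_square : (mu \x mu) (I `*` I : set (RR * RR)) = 1.
Proof.
have I1 : mu I = 1 by rewrite /= lebesgue_measure_itv /= lte_fin ltr01 sube0.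
have e := @product_measure1E _ _ RR RR R mu mu I I (measurable_itv _) (measurable_itv _).
by apply: (etrans e); rewrite -[RHS]mule1; congr (_ * _); exact: I1.
Qed.

Lemma measurable_square : measurable (I `*` I : set (RR * RR)).
Proof. by apply: measurableX; exact: measurable_itv. Qed.

Lemma L2_integrable (f : RR * RR -> R) : L2 f ->
  (mu \x mu).-integrable (I `*` I) (EFin \o f) /\
  (mu \x mu).-integrable (I `*` I) (EFin \o (fun p => f p ^+ 2)%R).
Proof.
move=> [mf f2].
have mf' : measurable_fun setT f by [].
have mf2 : measurable_fun setT (fun p => f p ^+ 2)%R by exact: measurable_funX.
have mI := measurable_square.
have i2 : (mu \x mu).-integrable (I `*` I) (EFin \o (fun p => f p ^+ 2)%R).
  apply: integrable_cell_closed => //.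
  have -> : (fun p => `|f p ^+ 2|%:E) = (fun p => (f p ^+ 2)%:E) :> (R * R -> _).
    by apply/funext => p; rewrite ger0_norm ?sqr_ge0.
  exact: f2.
split=> //.
have i1 : (mu \x mu).-integrable (I `*` I) (EFin \o (fun p : RR * RR => 1%R)).
  apply/integrableP; split; first by apply/measurable_EFinP; exact: measurable_cst.
  rewrite (eq_integral (cst 1)) => [|p _]; last by rewrite /= normr1.
  have m1' : (mu \x mu) (I `*` I) < +oo.
    by have := leb_square; rewrite /= => ->; rewrite ltry.
  by rewrite integral_cst// mul1e; exact: m1'.
(* Since the square has finite measure, [|f| <= 1 + f ^+ 2] gives integrability. *)
apply: (le_integrable mI _ _ (integrable_realD mI i1 i2)).
- exact/measurable_EFinP/measurable_funTS.
- move=> p _ /=; rewrite lee_fin [leRHS]ger0_norm; last first.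
    by rewrite addr_ge0// sqr_ge0.
  rewrite -[(f p ^+ 2)%R]real_normK ?num_real//.
  by have := sqr_ge0 (`|f p|%R - 1)%R; have := normr_ge0 (f p); nra.
Qed.

Lemma integrable_square_mul (f : RR * RR -> R) (h : RR -> R) :
  (mu \x mu).-integrable (I `*` I) (EFin \o f) -> continuous (h : R -> R) ->
  (mu \x mu).-integrable (I `*` I) (EFin \o (fun p => f p * h p.2)%R) /\
  (mu \x mu).-integrable (I `*` I) (EFin \o (fun p => f p * h p.1)%R).
Proof.
move=> fi ch; have [M hM] := bounded_on_segment ch.
have mI := measurable_square.
have mh : measurable_fun setT (h : RR -> R) by exact: continuous_measurable_fun.
split.
- apply: (@integrable_mul_bounded _ _ R (mu \x mu) _ f (fun p => h p.2) M mI fi).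
    by apply: measurable_funTS; exact: measurableT_comp.
  by move=> p [_ /= p2]; exact: hM.
- apply: (@integrable_mul_bounded _ _ R (mu \x mu) _ f (fun p => h p.1) M mI fi).
    by apply: measurable_funTS; exact: measurableT_comp.
  by move=> p [/= p1 _]; exact: hM.
Qed.

(** Testing with [psi x * Phi y] for a sigmoid [psi] and applying Fubini shows that the integral
    over the line at [x], as a function of [x], is orthogonal to every sigmoid, hence zero almost
    everywhere. The null set depends on [Phi]. *)
Lemma weak_dy_slice (f g : RR * RR -> R) (Phi rho : R -> R) :
  L2 f -> L2 g -> weak_dy f g -> smooth Phi -> (forall y, Phi (y + 1) = Phi y)%R ->
  continuous rho -> (forall y : R, is_derive y 1%R Phi (rho y)) ->
  {ae mu, forall x, I x -> (\int[mu]_(y in I) (f (x, y) * rho y + g (x, y) * Phi y) = 0)%R}.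
Proof.
move=> Lf Lg fg sPhi pPhi crho dPhi.
have [fi _] := L2_integrable Lf; have [gi _] := L2_integrable Lg.
have [mf _] := Lf; have [mg _] := Lg.
have mI := measurable_square.
have mIt : measurable (I : set RR) by exact: measurable_itv.
have cPhi := smooth_continuous sPhi.
pose k (p : RR * RR) : R := (f p * rho p.2 + g p * Phi p.2)%R.
have fri : (mu \x mu).-integrable (I `*` I) (EFin \o (fun p => f p * rho p.2)%R).
  by have [] := integrable_square_mul fi crho.
have gPi : (mu \x mu).-integrable (I `*` I) (EFin \o (fun p => g p * Phi p.2)%R).
  by have [] := integrable_square_mul gi cPhi.
have ki : (mu \x mu).-integrable (I `*` I) (EFin \o k) by exact: integrable_realD.
have [kae kI kE] := fubini_setX mIt mIt ki.
apply: ae_eq0_sig => // q n _.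
pose psi : R -> R := sig (ratr q) n%:R.
have cpsi : continuous psi by exact: continuous_sig.
have spsi : smooth psi by exact: smooth_sig.
have tst : test_fun (fun p => psi p.1 * Phi p.2)%R.
  by apply: test_fun_tensor => // y; exact: sig_periodic.
have dtst : dy (fun p => psi p.1 * Phi p.2)%R = (fun p => psi p.1 * rho p.2)%R.
  apply/funext => p; rewrite /dy derive1E; apply: derive_val.
  exact: (is_deriveZ (psi p.1) (dPhi p.2)).
have := fg _ tst; rewrite dtst.
have mT (u : RR * RR -> R) (h : R -> R) : measurable_fun setT u -> continuous h ->
    measurable_fun setT (fun p => u p * (psi p.1 * h p.2))%R.
  move=> mu' ch; have mh : measurable_fun setT (h : RR -> R) by exact: continuous_measurable_fun.
  have mpsi : measurable_fun setT (psi : RR -> R) by exact: continuous_measurable_fun.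
  by apply: measurable_funM => //; apply: measurable_funM; exact: measurableT_comp.
rewrite (integral_cell_closed_real (mT f rho mf crho)) (integral_cell_closed_real (mT g Phi mg cPhi)).
have fpi : (mu \x mu).-integrable (I `*` I) (EFin \o (fun p => f p * (psi p.1 * rho p.2))%R).
  have [_ ] := integrable_square_mul fri cpsi.
  by congr (integrable _ _ (EFin \o _)); apply/funext => p; ring.
have gpi : (mu \x mu).-integrable (I `*` I) (EFin \o (fun p => g p * (psi p.1 * Phi p.2))%R).
  have [_ ] := integrable_square_mul gPi cpsi.
  by congr (integrable _ _ (EFin \o _)); apply/funext => p; ring.
rewrite (EFin_Rintegral mI fpi) (EFin_Rintegral mI gpi) -EFinN => -[] /eqP.
rewrite -addr_eq0 -RintegralD// => /eqP.
rewrite (_ : (fun x => _)%R = (fun p => k p * psi p.1)%R); last first.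
  by apply/funext => p; rewrite /k; ring.
have [_ kpi] := integrable_square_mul ki cpsi.
have [_ kpI kpE] := fubini_setX mIt mIt kpi.
rewrite /Rintegral kpE => e; rewrite -[RHS]e; congr fine.
apply: ae_eq_integral => //.
- have mH := measurable_int _ kI.
  apply/measurable_EFinP; apply: measurable_funM; first exact/measurable_EFinP.
  by apply: measurable_funTS; exact: continuous_measurable_fun.
- exact: measurable_int kpI.
apply: filterS kae => x H Ix /=; congr EFin.
by rewrite RintegralZr//; exact: H.
Qed.

(** The test function 1 gives the zero mean of [g] on lines; primitives of centred sigmoids give the
    hypothesis of [du_Bois_Reymond]. *)
Lemma weak_dy_absolutely_continuous (f g : RR * RR -> R) :
  L2 f -> L2 g -> weak_dy f g ->
  {ae mu, forall x, I x ->
    (\int[mu]_(y in I) g (x, y) = 0)%R /\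
    exists kappa : R, {ae mu, forall y, I y ->
      f (x, y) = (kappa + \int[mu]_(t in `[0%R, y]) g (x, t))%R}}.
Proof.
move=> Lf Lg fg.
have mIt : measurable (I : set RR) by exact: measurable_itv.
have [fi _] := L2_integrable Lf; have [gi _] := L2_integrable Lg.
have [fae _ _] := fubini_setX mIt mIt fi; have [gae _ _] := fubini_setX mIt mIt gi.
have sk q n : smooth (sig (ratr q : R) n%:R) by exact: smooth_sig.
have pk q n y : (sig (ratr q : R) n%:R (y + 1) = sig (ratr q) n%:R y)%R by exact: sig_periodic.
pose Phi q n := projT1 (cid (periodic_primitive (sk q n) (pk q n))).
have PhiP q n := projT2 (cid (periodic_primitive (sk q n) (pk q n))).
pose rho q n y : R := (sig (ratr q) n%:R y - \int[mu]_(t in I) sig (ratr q) n%:R t)%R.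
have crho q n : continuous (rho q n).
  by move=> y; apply: cvgB; [exact: continuous_sig|exact: cvg_cst].
have test0 : {ae mu, forall x, I x -> (\int[mu]_(y in I) g (x, y) = 0)%R}.
  have c0 : continuous (cst 0%R : R -> R) by exact: cst_continuous.
  have d1 (y : R) : is_derive y 1%R (cst 1%R : R -> R) (cst 0%R y : R) by exact: is_derive_cst.
  have := weak_dy_slice Lf Lg fg (smooth_cst 1%R) (fun=> erefl) c0 d1.
  apply: filterS => x H Ix; rewrite -[RHS](H Ix).
  by apply: eq_Rintegral => y _; rewrite /= mulr0 add0r mulr1.
(* The pairs [(q, n)] are coded by one natural number, so that a single null set of lines serves all
   tests; numbers coding no pair give [0 = 0]. *)
have testP : {ae mu, forall x, forall m, I x ->
    (if unpickle m is Some (q, n) then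
      \int[mu]_(y in I) (f (x, y) * rho q n y + g (x, y) * Phi q n y) else 0)%R = 0%R}.
  apply: ae_foralln => m; case: (unpickle m) => [[q n]|]; last exact: aeW.
  by have [s p d] := PhiP q n; exact: weak_dy_slice Lf Lg fg s p (crho q n) d.
apply: (@filterS3 _ _ _ _ _ _ _ _ test0 testP (filterI fae gae)) => x H0 HP [Hf Hg] Ix.
split; first exact: H0.
apply: (@du_Bois_Reymond R _ _ Phi (Hf Ix) (Hg Ix) (H0 Ix)) => q n.
  by have [] := PhiP q n.
by have := HP (pickle (q, n)) Ix; rewrite pickleK.
Qed.

End cell.

(** * Estimates on a line *)

Lemma ae_le_Rintegral d (T : measurableType d) (R : realType)
    (mu : {measure set T -> \bar R}) (D : set T) (f g : T -> R) :
  measurable D -> mu.-integrable D (EFin \o f) -> mu.-integrable D (EFin \o g) ->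
  {ae mu, forall x, D x -> f x <= g x} ->
  \int[mu]_(x in D) f x <= \int[mu]_(x in D) g x.
Proof.
move=> mD fi gi fg; rewrite -subr_ge0 -RintegralB//.
have hi := integrable_realB mD gi fi.
have mh : measurable_fun D (fun x => g x - f x) by apply/measurable_EFinP; exact: measurable_int hi.
rewrite (@ae_eq_Rintegral _ _ _ _ D _ (fun x => `|g x - f x|))//.
- by apply: Rintegral_ge0 => x _.
- exact: measurableT_comp.
- apply: (@filterS _ _ (ae_filter_ringOfSetsType mu) _ _ _ fg) => x H Dx.
  by rewrite ger0_norm// subr_ge0; exact: H.
Qed.

Section segments.
Variable R : realType.
Notation mu := (@lebesgue_measure R).
Local Notation I := (`[(0 : R), 1]%classic).

Lemma Rintegral_segment_cst (a b k : R) : a <= b ->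
  \int[mu]_(t in `[a, b]) k = k * (b - a).
Proof.
move=> ab; rewrite Rintegral_cst//= lebesgue_measure_itv /= lte_fin.
by move: ab; rewrite le_eqVlt => /predU1P[->|->]; rewrite ?ltxx ?subrr.
Qed.

Lemma le_Rintegral_segment (a b c d : R) (f : R -> R) : a <= c -> c <= d -> d <= b ->
  mu.-integrable `[a, b] (EFin \o f) -> (forall y, 0 <= f y) ->
  \int[mu]_(t in `[c, d]) f t <= \int[mu]_(t in `[a, b]) f t.
Proof.
move=> ac cd db fi f0.
rewrite (@Rintegral_itv_split _ a c b)//; [|exact: le_trans db].
rewrite (@Rintegral_itv_split _ c d b)//; [|exact: integrable_itvS fi].
have : 0 <= \int[mu]_(t in `[a, c]) f t by apply: Rintegral_ge0.
have : 0 <= \int[mu]_(t in `[d, b]) f t by apply: Rintegral_ge0.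
lra.
Qed.

Lemma primitive_sub (f : R -> R) (k c d : R) : mu.-integrable I (EFin \o f) ->
  0 <= c -> c <= d -> d <= 1 ->
  (k + \int[mu]_(t in `[0, d]) f t) - (k + \int[mu]_(t in `[0, c]) f t) =
  \int[mu]_(t in `[c, d]) f t.
Proof.
move=> fi c0 cd d1; rewrite (@Rintegral_itv_split _ 0 c d)//; first by ring.
exact: integrable_itvS fi.
Qed.

Lemma primitive_dist_le (f : R -> R) (k a b c d : R) : mu.-integrable I (EFin \o f) ->
  0 <= a -> b <= 1 -> a <= c <= b -> a <= d <= b ->
  `|(k + \int[mu]_(t in `[0, d]) f t) - (k + \int[mu]_(t in `[0, c]) f t)| <=
  \int[mu]_(t in `[a, b]) `|f t|.
Proof.
move=> fi a0 b1.
wlog cd : c d / c <= d => [H c1 d1|/andP[ac cb] /andP[ad db]].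
  by have [/H|/ltW /H H'] := leP c d; [exact|rewrite distrC; exact: H'].
rewrite primitive_sub//; [|by lra..].
have fcd : mu.-integrable `[c, d] (EFin \o f) by apply: integrable_itvS fi; lra.
apply: (le_trans (le_normr_Rintegral _ fcd)) => //.
apply: le_Rintegral_segment => //.
by apply: integrable_norm; apply: integrable_itvS fi.
Qed.

(** Otherwise the functions would differ on a whole ball, which has positive measure. *)
Lemma ae_eq_continuous_at (f g : R -> R) (y : R) : 0 < y < 1 ->
  {ae mu, forall t, I t -> f t = g t} ->
  {for y, continuous f} -> {for y, continuous g} -> f y = g y.
Proof.
move=> y01 [N [mN N0 NP]] cf cg; apply: contrapT => /eqP; rewrite -subr_eq0 => nz.
have cfg : (fun t => f t - g t) @ y --> f y - g y by exact: cvgB.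
have near1 : \forall t \near y, f t - g t != 0 by exact: cvgr_neq0 cfg nz.
have near2 : \forall t \near y, t \in `](0 : R), 1[ by apply: near_in_itvoo; rewrite in_itv.
have [e /= e0 He] := filterI near1 near2.
have sub : ball y e `<=` N.
  move=> t yt; apply: NP => /= H; have [] := He t yt.
  rewrite in_itv /= => nz' t01; case/eqP: nz'; rewrite H ?subrr//.
  by rewrite in_itv /=; lra.
have : (mu (ball y e) <= mu N)%E by apply: le_measure => //; rewrite inE//; exact: measurable_ball.
move=> H; have H1 := lebesgue_measure_ball y (ltW e0).
have : e *+ 2 <= 0 by rewrite -lee_fin; move: H; rewrite H1 N0.
by rewrite mulr2n; lra.
Qed.

Lemma primitive_continuous_at (f : R -> R) (k y : R) : mu.-integrable I (EFin \o f) ->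
  0 < y < 1 -> {for y, continuous (fun t : R => k + \int[mu]_(s in `[0, t]) f s)}.
Proof.
move=> fi y01.
have [+ _ _] := (continuous_within_itvP _ ltr01).1 (parameterized_integral_continuous ler01 fi).
have yin : y \in `](0 : R), 1[ by rewrite in_itv.
by move=> /(_ y yin) cy; apply: cvgD; [exact: cvg_cst|exact: cy].
Qed.

(* [U] is continuously differentiable inside [I], and minimal where it vanishes. *)
Lemma primitive_vanishes (U f q : R -> R) (k v0 : R) (Om : set R) :
  continuous U -> (forall y, 0 <= U y) -> (forall y, Om y -> U y = 0) ->
  mu.-integrable I (EFin \o f) -> mu.-integrable I (EFin \o q) ->
  {ae mu, forall y, I y -> U y = k + \int[mu]_(t in `[0, y]) f t} ->
  {ae mu, forall y, I y -> f y = v0 + \int[mu]_(t in `[0, y]) q t} ->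
  forall y, Om y -> 0 < y < 1 -> v0 + \int[mu]_(t in `[0, y]) q t = 0.
Proof.
move=> cU U0 UOm fi qi UE fE y Omy y01.
pose v t := v0 + \int[mu]_(s in `[0, t]) q s.
have cv t : 0 < t < 1 -> {for t, continuous v} by move=> t01; exact: primitive_continuous_at.
have vi : mu.-integrable I (EFin \o v).
  have ci : mu.-integrable I (EFin \o cst v0) by apply: continuous_itv_integrable; exact: cst_continuous.
  exact: (@integrable_realD _ _ R mu I (measurable_itv _) _ _ ci (integrable_primitive qi)).
pose V t := k + \int[mu]_(s in `[0, t]) v s.
(* Replacing [f] by its continuous representative [v] under the integral makes the primitive
   differentiable at every interior point. *)
have UVae : {ae mu, forall s, I s -> U s = V s}.
  apply: filterS UE => s H Is; rewrite (H Is) /V; congr (_ + _).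
  have Is' : 0 <= s <= 1 by move: Is; rewrite /= in_itv.
  have mf : measurable_fun I f by apply/measurable_EFinP; exact: measurable_int fi.
  have mv : measurable_fun I v by apply/measurable_EFinP; exact: measurable_int vi.
  have sub : (`[0, s] `<=` I)%classic by apply: subset_itvl; rewrite bnd_simp; lra.
  apply: ae_eq_Rintegral => //; [exact: measurable_funS mf|exact: measurable_funS mv|].
  by apply: filterS fE => r Hr rs; apply: Hr; exact: sub.
have UV (t : R) : 0 < t < 1 -> U t = V t.
  move=> t01; have cVt := primitive_continuous_at (k := k) vi t01.
  exact: (ae_eq_continuous_at t01 UVae (cU t) cVt).
have dV (t : R) : 0 < t < 1 -> is_derive t 1 V (v t).
  move=> t01; have t1 : t < 1 by lra.
  have t0 : 0 < t by lra.
  have [d1 d2] := continuous_FTC1_closed t1 vi t0 (cv t t01).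
  have dt : is_derive t 1 (fun t => \int[mu]_(s in `[0, t]) v s) (v t).
    by apply: DeriveDef; [exact: d1|rewrite -derive1E; exact: d2].
  by have := is_deriveD (is_derive_cst k t (1 : R)) dt; rewrite add0r.
rewrite -/(v y); have [_ <-] := dV y y01.
have min0 : is_derive y 1 V 0.
  apply: (@derive1_at_min R V 0 1 y) => //.
  - by move=> t; rewrite in_itv /= => t01; case: (dV t t01).
  - by move=> t; rewrite in_itv /= => t01; rewrite -!UV// (UOm y Omy).
by case: min0.
Qed.

Section slice.
(** On a vertical line [q], [g], [m] are the restrictions of d_yy u, d_y w_2 and the mismatch; [v]
    and [W] are the absolutely continuous representatives of d_y u and w_2. *)
Variables (q g m : R -> R) (v0 kappa eta : R).
Hypothesis eta0 : 0 < eta.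
Hypothesis qi : mu.-integrable I (EFin \o q).
Hypothesis q2i : mu.-integrable I (EFin \o (fun y => q y ^+ 2)).
Hypothesis gi : mu.-integrable I (EFin \o g).
Hypothesis mi : mu.-integrable I (EFin \o m).
Let v y := v0 + \int[mu]_(t in `[0, y]) q t.
Let W y := kappa + \int[mu]_(t in `[0, y]) g t.
Hypothesis gE : {ae mu, forall y, I y -> g y = eta + m y - v y ^+ 2 / 2}.

(** Cauchy-Schwarz on a segment of length at most [N^-1]: starting from 0 at [y0], [v] reaches at
    most the square root of [N^-1 * (eta * N)]. *)
Lemma segment_slope_le (a b N y0 y : R) : 0 <= a -> b <= 1 -> 0 < N -> b - a <= N^-1 ->
  a <= y0 <= b -> a <= y <= b -> v y0 = 0 ->
  \int[mu]_(t in `[a, b]) (q t ^+ 2) <= eta * N -> v y ^+ 2 <= eta.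
Proof.
move=> a0 b1 N0 ba y0ab yab vy0 b2.
have ab : a <= b by lra.
have qab : mu.-integrable `[a, b] (EFin \o q) by exact: integrable_itvS qi.
have q2ab : mu.-integrable `[a, b] (EFin \o (fun y => q y ^+ 2)) by exact: integrable_itvS q2i.
pose s := Num.sqrt eta.
have s0 : 0 < s by rewrite sqrtr_gt0.
have s2 : s * s = eta by rewrite -expr2 sqr_sqrtr// ltW.
have Ns0 : 0 < N * s by rewrite mulr_gt0.
have vys : `|v y| <= s.
  have := primitive_dist_le v0 qi a0 b1 y0ab yab; rewrite -/(v y) -/(v y0) vy0 subr0.
  move=> /le_trans; apply.
  have ci : mu.-integrable `[a, b] (EFin \o (fun=> N * s / 2)).
    by apply: continuous_itv_integrable; exact: cst_continuous.
  have zi : mu.-integrable `[a, b] (EFin \o (fun t => (2 * (N * s))^-1 * q t ^+ 2)).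
    exact: integrable_realZ.
  apply: (@le_trans _ _ (\int[mu]_(t in `[a, b]) (N * s / 2 + (2 * (N * s))^-1 * q t ^+ 2))).
    apply: le_Rintegral => //; first exact: integrable_norm.
      exact: integrable_realD.
    move=> t _.
    (* AM-GM, weighted so that both halves integrate to at most [s / 2] *)
    have e : (`|q t| - N * s) ^+ 2 / (2 * (N * s)) =
        N * s / 2 + (2 * (N * s))^-1 * `|q t| ^+ 2 - `|q t|.
      by field; rewrite !gt_eqF.
    rewrite -[q t ^+ 2]real_normK ?num_real// -subr_ge0 -e.
    by rewrite divr_ge0 ?sqr_ge0// mulr_ge0// ltW.
  rewrite RintegralD// Rintegral_segment_cst// RintegralZl//.
  have h1 : N * s / 2 * (b - a) <= s / 2.
    have : N * s / 2 * (b - a) <= N * s / 2 * N^-1 by rewrite ler_wpM2l// ltW// divr_gt0.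
    by move=> /le_trans; apply; rewrite le_eqVlt; apply/orP; left; apply/eqP; field; rewrite gt_eqF.
  have h2 : (2 * (N * s))^-1 * \int[mu]_(x in `[a, b]) q x ^+ 2 <= s / 2.
    have : (2 * (N * s))^-1 * \int[mu]_(x in `[a, b]) q x ^+ 2 <= (2 * (N * s))^-1 * (eta * N).
      by rewrite ler_wpM2l// invr_ge0 mulr_ge0// ltW.
    move=> /le_trans; apply; rewrite -s2 le_eqVlt; apply/orP; left; apply/eqP.
    by field; rewrite !gt_eqF.
  lra.
rewrite -s2 -expr2 -[v y ^+ 2]real_normK ?num_real//.
by rewrite lerXn2r ?nnegrE// ltW.
Qed.

(** Where [v ^+ 2 <= eta], the relation [gE] gives [g >= eta / 2 - |m|]. The error is integrated
    over all of [[a, b]] so as not to depend on [c] and [d]. *)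
Lemma growth (a b c d : R) : 0 <= a -> b <= 1 -> a <= c -> c <= d -> d <= b ->
  (forall y, a <= y <= b -> v y ^+ 2 <= eta) ->
  eta / 2 * (d - c) - \int[mu]_(t in `[a, b]) `|m t| <= W d - W c.
Proof.
move=> a0 b1 ac cd db vb.
rewrite /W primitive_sub//; [|by lra..].
have mabi : mu.-integrable `[a, b] (EFin \o (fun t => `|m t|)).
  by apply: integrable_norm; exact: integrable_itvS mi.
have mcdi : mu.-integrable `[c, d] (EFin \o (fun t => `|m t|)) by exact: integrable_itvS mabi.
have ci : mu.-integrable `[c, d] (EFin \o (fun=> eta / 2)).
  by apply: continuous_itv_integrable; exact: cst_continuous.
have := le_Rintegral_segment ac cd db mabi (fun y => normr_ge0 (m y)).
suff : \int[mu]_(t in `[c, d]) (eta / 2 - `|m t|) <= \int[mu]_(t in `[c, d]) g t.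
  by rewrite RintegralB// Rintegral_segment_cst//; lra.
apply: ae_le_Rintegral => //; first exact: integrable_realB.
  by apply: integrable_itvS gi; lra.
apply: filterS gE => t H; rewrite /= in_itv /= => tcd.
rewrite H; last by rewrite /= in_itv /=; lra.
have : v t ^+ 2 <= eta by apply: vb; lra.
have := ler_norm (- m t); rewrite normrN; lra.
Qed.

(** If the bending term is below [eta], then [v ^+ 2 <= eta] on the whole line and [W] would grow by
    [eta / 2] up to the error [m]; as [W] returns to its initial value, the error must be that
    large. *)
Lemma stretched_slice (y0 : R) : 0 < y0 < 1 -> v y0 = 0 -> \int[mu]_(t in I) g t = 0 ->
  eta <= \int[mu]_(t in I) (q t ^+ 2 + 2 * `|m t|).
Proof.
move=> y01 vy0 g0.
have ami : mu.-integrable I (EFin \o (fun t => `|m t|)) by exact: integrable_norm.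
have ami2 : mu.-integrable I (EFin \o (fun t => 2 * `|m t|)) by exact: integrable_realZ.
rewrite RintegralD// RintegralZl//.
have m0 : 0 <= \int[mu]_(t in I) `|m t| by apply: Rintegral_ge0.
have [big|small] := leP eta (\int[mu]_(t in I) (q t ^+ 2)).
  by rewrite (le_trans big)// lerDl mulr_ge0.
have vb y : 0 <= y <= 1 -> v y ^+ 2 <= eta.
  move=> yI; apply: (@segment_slope_le 0 1 1 y0) => //; first by rewrite subr0 invr1.
    by lra.
  by rewrite mulr1 ltW.
have := growth (lexx 0) (lexx 1) (lexx 0) ler01 (lexx 1) vb.
rewrite /W g0 set_itv1 Rintegral_set1 subrr subr0 mulr1 subr_le0 => h.
apply: (@le_trans _ _ (2 * \int[mu]_(t in I) `|m t|)); last first.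
  by rewrite lerDr; apply: Rintegral_ge0 => t _; exact: sqr_ge0.
by rewrite mulrC -ler_pdivrMr.
Qed.

Variables (P : set R) (s : R).
Hypothesis s0 : 0 <= s.
Hypothesis PW : forall y, P y -> 0 < y < 1 /\ v y = 0 /\ `|W y| <= s.
Hypothesis mP : measurable (P : set (measurableTypeR R)).

(** If the bending term exceeds [eta * N], the first summand already exceeds the length of the
    segment. Otherwise, as soon as [P] meets the segment, [W] grows steadily there and its values on
    [P] stay within [s] of 0, which forces the points of [P] close together. *)
Lemma small_on_segment (a b N : R) : 0 <= a -> a <= b -> b <= 1 -> 0 < N -> b - a <= N^-1 ->
  (mu (P `&` `[a, b]) <= (\int[mu]_(t in `[a, b]) (q t ^+ 2) / (eta * N ^+ 2) +
     8 * s / eta + 4 / eta * \int[mu]_(t in `[a, b]) `|m t|)%:E)%E.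
Proof.
move=> a0 ab b1 N0 ba.
set Q := \int[mu]_(t in _) _; set M := \int[mu]_(t in _) _.
have Q0 : 0 <= Q by apply: Rintegral_ge0 => t _; exact: sqr_ge0.
have M0 : 0 <= M by apply: Rintegral_ge0.
have Qt : 0 <= Q / (eta * N ^+ 2) by rewrite divr_ge0// mulr_ge0 ?sqr_ge0// ltW.
have st : 0 <= 8 * s / eta by rewrite divr_ge0 ?mulr_ge0// ltW.
have Mt : 0 <= 4 / eta * M by rewrite mulr_ge0// divr_ge0// ltW.
have [big|small] := ltP (eta * N) Q.
  apply: (@le_trans _ _ (mu `[a, b])).
    by apply: le_measure; rewrite ?inE//; apply: measurableI.
  rewrite lebesgue_measure_itv /= lte_fin; case: ifPn => _; rewrite ?lee_fin; last by lra.
  have : N^-1 <= Q / (eta * N ^+ 2).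
    rewrite ler_pdivlMr ?mulr_gt0 ?exprn_gt0//.
    by rewrite (le_trans _ (ltW big))// le_eqVlt; apply/orP; left; apply/eqP; field; rewrite gt_eqF.
  lra.
have [->|/set0P[p [Pp pab]]] := eqVneq (P `&` `[a, b]%classic) set0.
  by rewrite measure0 lee_fin; lra.
have [p01 [vp Wp]] := PW Pp.
have pab' : a <= p <= b by move: pab; rewrite /= in_itv.
have vb y : a <= y <= b -> v y ^+ 2 <= eta.
  by move=> yab; exact: (segment_slope_le a0 b1 N0 ba pab' yab vp small).
(* Between two points of [P] the increment of [W] is at most [2 * s]; [growth] turns this into a
   bound on their distance. *)
pose dlt := 2 * (2 * s + M) / eta.
have dlt0 : 0 <= dlt by rewrite divr_ge0 ?mulr_ge0 ?addr_ge0 ?mulr_ge0// ltW.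
have close c d : a <= c <= b -> a <= d <= b -> c <= d -> `|W c| <= s -> `|W d| <= s ->
    d - c <= dlt.
  move=> /andP[ac cb] /andP[ad db] cd Wc Wd.
  have := growth a0 b1 ac cd db vb; rewrite -/M => gr.
  have h1 := ler_norm (W d); have h2 := ler_norm (- W c); rewrite normrN in h2.
  rewrite /dlt ler_pdivlMr//; lra.
apply: (@le_trans _ _ (mu `[p - dlt, p + dlt])).
  apply: le_measure; rewrite ?inE//; first by apply: measurableI.
  move=> y [/PW[y01 [vy Wy]]]; rewrite /= !in_itv /= => yab.
  have [py|/ltW yp] := leP p y.
    by have := close _ _ pab' yab py Wp Wy; lra.
  by have := close _ _ yab pab' yp Wy Wp; lra.
rewrite lebesgue_measure_itv /= lte_fin; case: ifPn => _; rewrite ?lee_fin; last by lra.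
have -> : p + dlt - (p - dlt) = 8 * s / eta + 4 / eta * M.
  by rewrite /dlt; field; rewrite gt_eqF.
lra.
Qed.

Lemma small_on_slice (n : nat) : (0 < n)%N ->
  (mu (P `&` I) <= (\int[mu]_(t in I)
     ((eta * n%:R ^+ 2)^-1 * q t ^+ 2 + 8 * s * n%:R / eta + 4 / eta * `|m t|))%:E)%E.
Proof.
move=> n0; have N0 : 0 < n%:R :> R by rewrite ltr0n.
have ami : mu.-integrable I (EFin \o (fun t => `|m t|)) by exact: integrable_norm.
(* Induction over the first [k] of the [n] equal segments: the integrals add up and each segment
   contributes one [8 * s / eta]. *)
suff H k : (k <= n)%N -> (mu (P `&` `[0%R, (k%:R / n%:R)%R]) <=
    (\int[mu]_(t in `[0, k%:R / n%:R]) (q t ^+ 2) / (eta * n%:R ^+ 2) + 8 * s / eta * k%:R +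
     4 / eta * \int[mu]_(t in `[0, k%:R / n%:R]) `|m t|)%:E)%E.
  have := H n (leqnn n); rewrite divff ?gt_eqF//.
  have ci : mu.-integrable I (EFin \o (fun=> 8 * s * n%:R / eta)).
    by apply: continuous_itv_integrable; exact: cst_continuous.
  have z1 : mu.-integrable I (EFin \o (fun t => (eta * n%:R ^+ 2)^-1 * q t ^+ 2)).
    exact: integrable_realZ.
  have z2 : mu.-integrable I (EFin \o (fun t => 4 / eta * `|m t|)) by exact: integrable_realZ.
  have z3 := @integrable_realD _ _ R mu I (measurable_itv _) _ _ z1 ci.
  rewrite (RintegralD _ z3 z2)// (RintegralD _ z1 ci)// (Rintegral_segment_cst _ ler01) !RintegralZl//.
  move=> /le_trans; apply; rewrite lee_fin.
  by rewrite subr0 mulr1 [(_)^-1 * _]mulrC [8 * s / eta * _]mulrAC.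
elim: k => [_|k IH kn].
  rewrite mul0r set_itv1 !Rintegral_set1 !mul0r !mulr0 !addr0.
  apply: (@le_trans _ _ (mu [set 0%R])); last by rewrite lebesgue_measure_set1.
  by apply: le_measure; rewrite ?inE//; apply: measurableI.
have kn' : (k <= n)%N by exact: ltnW.
have {}IH := IH kn'.
pose a : R := k%:R / n%:R; pose b : R := k.+1%:R / n%:R; rewrite -/b.
rewrite -/a in IH.
have a0 : 0 <= a by rewrite divr_ge0.
have ba : b - a = n%:R^-1 by rewrite /a /b -mulrBl -natrB// subSnn mul1r.
have ab : a <= b by rewrite -subr_ge0 ba invr_ge0.
have b1 : b <= 1 by rewrite ler_pdivrMr// mul1r ler_nat.
have ba' : b - a <= n%:R^-1 by rewrite ba.
have seg := small_on_segment a0 ab b1 N0 ba'.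
have bi : mu.-integrable `[0, b] (EFin \o (fun t => `|m t|)) by exact: integrable_itvS ami.
have bq : mu.-integrable `[0, b] (EFin \o (fun t => q t ^+ 2)) by exact: integrable_itvS q2i.
rewrite (Rintegral_itv_split a0 ab bi) (Rintegral_itv_split a0 ab bq).
apply: (@le_trans _ _ (mu (P `&` `[0%R, a]) + mu (P `&` `[a, b]))%E).
  have -> : P `&` `[0%R, b] = (P `&` `[0%R, a]) `|` (P `&` `[a, b]).
    apply/seteqP; split=> y /=; rewrite !in_itv /=.
      by move=> [Py yb]; have [ya|/ltW ya] := leP y a; [left|right]; split=> //; lra.
    by move=> [[Py ya]|[Py ya]]; split=> //; lra.
  by apply: measureU2; apply: measurableI.
apply: (le_trans (leeD IH seg)); rewrite -EFinD lee_fin -natr1.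
by rewrite le_eqVlt; apply/orP; left; apply/eqP; field; rewrite !gt_eqF.
Qed.

End slice.

End segments.

(** * Integration over the lines *)

Section slices.
Variable R : realType.
Notation mu := (@lebesgue_measure R).
Local Notation I := (`[(0 : R), 1]%classic).
Local Notation RR := (measurableTypeR R).

(** The complement is the union of the countably many boxes with rational centre and radius that it
    contains, and boxes belong to the product sigma-algebra. *)
Lemma measurable_closed_pair (A : set (RR * RR)) : closed (A : set (R * R)) -> measurable A.
Proof.
rewrite -openC => oA; rewrite -[A]setCK; apply: measurableC.
set O := ~` A.
pose box (i : rat * rat * rat) : set (RR * RR) :=
  `]ratr i.1.1 - ratr i.2, ratr i.1.1 + ratr i.2[%classic `*`
  `]ratr i.1.2 - ratr i.2, ratr i.1.2 + ratr i.2[%classic.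
pose F i : set (RR * RR) := if `[< box i `<=` O >] then box i else set0.
have -> : O = \bigcup_i F i.
  apply/seteqP; split=> [p Op|p [i _]]; last first.
    by rewrite /F; case: ifPn => [/asboolP sub|_ //]; exact: sub.
  have /nbhs_ballP[e /= e0 pe] : nbhs (p : R * R) O by exact: open_nbhs_nbhs.
  (* The centre is within [r] of [p] in each coordinate, so the box contains [p] and stays within
     [2 * r < e] of it. *)
  have /rat_in_itvoo[r /itvP re] : 0 < e / 2 by rewrite divr_gt0.
  have r0 : 0 < (ratr r : R) by rewrite re.
  have re2 : (ratr r : R) < e / 2 by rewrite re.
  have /rat_in_itvoo[q1 /itvP q1p] : p.1 < p.1 + ratr r by rewrite ltrDl.
  have /rat_in_itvoo[q2 /itvP q2p] : p.2 < p.2 + ratr r by rewrite ltrDl.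
  have h1 : p.1 < ratr q1 by rewrite q1p.
  have h2 : ratr q1 < p.1 + ratr r by rewrite q1p.
  have h3 : p.2 < ratr q2 by rewrite q2p.
  have h4 : ratr q2 < p.2 + ratr r by rewrite q2p.
  have sub : box (q1, q2, r) `<=` O.
    move=> t [/= t1 t2]; apply: pe; move: t1 t2; rewrite !in_itv /= => t1 t2.
    by split; rewrite /ball /= /ball_ /= ltr_norml; lra.
  exists (q1, q2, r) => //; rewrite /F; case: ifPn => [_|/asboolP //].
  by split=> /=; rewrite in_itv /=; lra.
apply: countable_bigcupT_measurable => // i; rewrite /F.
by case: ifPn => // _; apply: measurableX; exact: measurable_itv.
Qed.

Lemma continuous_vertical (f : R * R -> R) : continuous f ->
  forall x, continuous (fun y => f (x, y)).
Proof.
move=> cf x y; have h : (fun t : R => (x, t)) @ y --> (x, y).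
  move=> A /= [[B C] /= [nB nC] sub]; apply: filterS nC => t Ct.
  by apply: sub; split=> //=; exact: nbhs_singleton nB.
exact: (cvg_comp _ _ h (cf (x, y))).
Qed.

Variables (w wy U Uy Uyy : RR * RR -> R) (Om : set (RR * RR)) (eta : R).
Hypothesis eta0 : 0 < eta.
Hypotheses (Lw : L2 w) (Lwy : L2 wy) (LU : L2 U) (LUy : L2 Uy) (LUyy : L2 Uyy).
Hypotheses (Dw : weak_dy w wy) (DU : weak_dy U Uy) (DUy : weak_dy Uy Uyy).
Hypotheses (cU : continuous (U : R * R -> R)) (U0 : forall p, 0 <= U p).
Hypotheses (UOm : forall p, Om p -> U p = 0) (mOm : measurable Om).
Let m (p : RR * RR) : R := wy p + Uy p ^+ 2 / 2 - eta.

(** Collects what holds on almost every vertical line; [v0] and [kappa] are the integration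
    constants of [Uy] and [w] there. *)
Record slice_data (x v0 kappa : R) : Prop := SliceData {
  slice_q : mu.-integrable I (EFin \o (fun y => Uyy (x, y)));
  slice_q2 : mu.-integrable I (EFin \o (fun y => Uyy (x, y) ^+ 2));
  slice_g : mu.-integrable I (EFin \o (fun y => wy (x, y)));
  slice_m : mu.-integrable I (EFin \o (fun y => m (x, y)));
  slice_g0 : \int[mu]_(y in I) wy (x, y) = 0;
  slice_w : {ae mu, forall y, I y -> w (x, y) = kappa + \int[mu]_(t in `[0, y]) wy (x, t)};
  slice_v : {ae mu, forall y, I y -> Uy (x, y) = v0 + \int[mu]_(t in `[0, y]) Uyy (x, t)};
  slice_Om : forall y, Om (x, y) -> 0 < y < 1 ->
    v0 + \int[mu]_(t in `[0, y]) Uyy (x, t) = 0 }.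

Lemma slice_dataP :
  {ae mu, forall x, I x -> exists v0 kappa, slice_data x v0 kappa}.
Proof.
have mI : measurable (I : set RR) by exact: measurable_itv.
have [wyi _] := L2_integrable Lwy; have [Uyi Uy2i] := L2_integrable LUy.
have [Uyyi Uyy2i] := L2_integrable LUyy.
have [A1 _ _] := fubini_setX mI mI wyi; have [A2 _ _] := fubini_setX mI mI Uyi.
have [A3 _ _] := fubini_setX mI mI Uy2i; have [A4 _ _] := fubini_setX mI mI Uyyi.
have [A5 _ _] := fubini_setX mI mI Uyy2i.
have B1 := weak_dy_absolutely_continuous Lw Lwy Dw.
have B2 := weak_dy_absolutely_continuous LU LUy DU.
have B3 := weak_dy_absolutely_continuous LUy LUyy DUy.
have aF := ae_lebesgue_filter R.
have AA := @filterI _ _ aF _ _ A1 (@filterI _ _ aF _ _ A2 (@filterI _ _ aF _ _ A3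
  (@filterI _ _ aF _ _ A4 A5))).
have BB := @filterI _ _ aF _ _ B1 (@filterI _ _ aF _ _ B2 B3).
apply: (@filterS2 _ _ aF _ _ _ _ AA BB) => x [H1 [H2 [H3 [H4 H5]]]] [K1 [K2 K3]] Ix.
have [g0 [kappa wE]] := K1 Ix; have [_ [k UE]] := K2 Ix; have [_ [v0 vE]] := K3 Ix.
exists v0, kappa; split; [exact: H4|exact: H5|exact: H1| |exact: g0|exact: wE|exact: vE|].
- have ce : mu.-integrable I (EFin \o (fun=> eta)).
    by apply: continuous_itv_integrable; exact: cst_continuous.
  have c2 : mu.-integrable I (EFin \o (fun y => 2^-1 * Uy (x, y) ^+ 2)).
    exact: (@integrable_realZ _ _ R mu I mI _ _ (H3 Ix)).
  have := @integrable_realB _ _ R mu I mI _ _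
    (@integrable_realD _ _ R mu I mI _ _ (H1 Ix) c2) ce.
  congr (integrable _ _ (EFin \o _)); apply/funext => y.
  by rewrite /m mulrC.
- have cUx := @continuous_vertical U cU x.
  exact: (@primitive_vanishes R (fun y => U (x, y)) (fun y => Uy (x, y)) (fun y => Uyy (x, y))
    k v0 [set y | Om (x, y)] cUx (fun y => U0 (x, y)) (fun y => @UOm (x, y)) (H2 Ix) (H4 Ix) UE vE).
Qed.

Lemma slice_gE x v0 kappa : slice_data x v0 kappa ->
  {ae mu, forall y, I y -> wy (x, y) =
     eta + m (x, y) - (v0 + \int[mu]_(t in `[0, y]) Uyy (x, t)) ^+ 2 / 2}.
Proof.
move=> S; apply: filterS (slice_v S) => y H Iy.
by rewrite -(H Iy) /m; ring.
Qed.

Lemma measurable_slice (x : R) : measurable ([set y | Om (x, y)] : set RR).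
Proof.
have := measurable_xsection x mOm; rewrite /xsection.
by congr measurable; apply/seteqP; split=> y /=; rewrite inE.
Qed.

Lemma measurable_mismatch : measurable_fun setT m.
Proof.
have [mwy _] := Lwy; have [mUy _] := LUy.
have mwy' : measurable_fun setT (wy : RR * RR -> R) by exact: mwy.
have mUy' : measurable_fun setT (Uy : RR * RR -> R) by exact: mUy.
apply: measurable_funB => //; apply: measurable_funD => //.
by apply: measurable_funM => //; exact: measurable_funX.
Qed.

Local Notation II := (I `*` I : set (RR * RR)).
Local Notation leb := (mu \x mu)%E.

Lemma measurable_L2 (f : RR * RR -> R) : L2 f -> measurable_fun setT f.
Proof. by case. Qed.

(** A line meeting [Om] contributes at most [eta] on the left, and [stretched_slice] provides [eta]
    on the right. *)
Lemma stretched_integral :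
  (\int[leb]_(p in II) (eta * \1_Om p)%:E <=
   \int[leb]_(p in II) (Uyy p ^+ 2 + 2 * `|m p|)%:E)%E.
Proof.
have mI : measurable (I : set RR) by exact: measurable_itv.
have mm := measurable_mismatch; have mUyy := measurable_L2 LUyy.
apply: le_integral_setX => //.
- by apply/measurable_EFinP; apply: measurable_funM => //; exact: measurable_indic.
- apply/measurable_EFinP; apply: measurable_funD; first exact: measurable_funX.
  by apply: measurable_funM => //; exact: measurableT_comp.
- by move=> p; rewrite lee_fin mulr_ge0// ltW.
- by move=> p; rewrite lee_fin addr_ge0 ?sqr_ge0// mulr_ge0.
apply: filterS slice_dataP => x H Ix; have [v0 [kappa S]] := H Ix.
have [[y0 [Omy0 y01]]|none] := pselect (exists y, Om (x, y) /\ 0 < y < 1).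
  have ineq := @stretched_slice R (fun y => Uyy (x, y)) (fun y => wy (x, y)) (fun y => m (x, y))
    v0 kappa eta eta0 (slice_q S) (slice_q2 S) (slice_g S) (slice_m S) (slice_gE S) y0 y01
    (slice_Om S Omy0 y01) (slice_g0 S).
  have i1 : mu.-integrable I (EFin \o (fun y => 2 * `|m (x, y)|)).
    by apply: integrable_realZ => //; exact: (integrable_norm (slice_m S)).
  have i2 := @integrable_realD _ _ R mu I mI _ _ (slice_q2 S) i1.
  rewrite (EFin_Rintegral mI i2).
  apply: (@le_trans _ _ eta%:E); last by rewrite lee_fin.
  apply: (@le_trans _ _ (\int[mu]_(y in I) eta%:E)%E).
    apply: ge0_le_integral => //.
    - by move=> y _; rewrite lee_fin mulr_ge0// ltW.
    - apply/measurable_EFinP; apply: measurable_funM => //.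
      apply: measurable_funTS; exact: (measurable_indic (measurable_slice x)).
    - by move=> y _; rewrite lee_fin ler_piMr ?(ltW eta0)// indicE lern1 leq_b1.
  by rewrite integral_cst//= lebesgue_measure_itv /= lte_fin ltr01 sube0 mule1.
(* On the remaining lines [Om] meets the unit segment at most in its two end points, a null set. *)
rewrite (ae_eq_integral (cst 0%E))//.
- rewrite integral0; apply: integral_ge0 => y _.
  by rewrite lee_fin addr_ge0 ?sqr_ge0// mulr_ge0.
- apply/measurable_EFinP; apply: measurable_funM => //.
  apply: measurable_funTS; exact: (measurable_indic (measurable_slice x)).
have := ae_neq (0 : R); have := ae_neq (1 : R).
apply: filterS2 => y y1 y0; rewrite /= in_itv /= => /andP[yge0 yle1].
rewrite indicE memNset ?mulr0// => Oxy; apply: none; exists y; split=> //.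
by rewrite !lt_neqAle eq_sym y0 y1 yge0.
Qed.

Lemma measurable_small (s : R) : measurable (Om `&` [set p | `|w p| <= s]).
Proof.
apply: measurableI => //; have mw := measurable_L2 Lw.
have -> : [set p | `|w p| <= s] = (fun p => `|w p|) @^-1` `]-oo, s].
  by apply/seteqP; split=> p /=; rewrite in_itv.
rewrite -[X in measurable X]setTI.
have : measurable_fun setT (fun p => `|w p|) by exact: measurableT_comp.
exact.
Qed.

Lemma small_integral (s : R) (n : nat) : 0 <= s -> (0 < n)%N ->
  (\int[leb]_(p in II) (\1_(Om `&` [set p | (`|w p| <= s)%R]) p)%:E <=
   \int[leb]_(p in II)
     ((eta * n%:R ^+ 2)^-1 * Uyy p ^+ 2 + 8 * s * n%:R / eta + 4 / eta * `|m p|)%:E)%E.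
Proof.
move=> s0 n0.
have mI : measurable (I : set RR) by exact: measurable_itv.
have mm := measurable_mismatch; have mUyy := measurable_L2 LUyy.
set P := Om `&` _.
have mP : measurable P.
  exact: measurable_small.
apply: le_integral_setX => //.
- by apply/measurable_EFinP; exact: measurable_indic.
- apply/measurable_EFinP; apply: measurable_funD; last first.
    by apply: measurable_funM => //; exact: measurableT_comp.
  by apply: measurable_funD => //; apply: measurable_funM => //; exact: measurable_funX.
- have e0 := ltW eta0; move=> p; rewrite lee_fin; apply: addr_ge0.
    apply: addr_ge0; last by rewrite divr_ge0 ?mulr_ge0.
    by apply: mulr_ge0; rewrite ?invr_ge0 ?sqr_ge0 ?mulr_ge0 ?sqr_ge0.
  by rewrite mulr_ge0 ?divr_ge0.
apply: filterS slice_dataP => x H Ix; have [v0 [kappa S]] := H Ix.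
have [N [mN N0 NP]] := slice_w S.
pose Px : set RR := [set y | P (x, y)].
have mPx : measurable Px.
  have := measurable_xsection x mP; rewrite /xsection.
  by congr measurable; apply/seteqP; split=> y /=; rewrite inE.
(* [small_on_slice] asks for its hypotheses at every point of the set, so the end points and the
   null set where [w] differs from [W] are removed first. *)
pose Q : set RR := (Px `&` `]0, 1[) `\` N.
have mQ : measurable Q by apply: measurableD => //; apply: measurableI.
pose W y := kappa + \int[mu]_(t in `[0, y]) wy (x, t).
have QW y : Q y -> 0 < y < 1 /\ v0 + \int[mu]_(t in `[0, y]) Uyy (x, t) = 0 /\ `|W y| <= s.
  move=> [[[Omy wy_s]]]; rewrite /= in_itv /= => y01 yN; split=> //.
  split; first exact: (slice_Om S Omy y01).
  have -> : W y = w (x, y); last exact: wy_s.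
  apply/esym; apply: contrapT => ne; apply: yN; apply: NP => /= H'; apply: ne.
  by apply: H'; rewrite in_itv /=; lra.
have ineq := @small_on_slice R (fun y => Uyy (x, y)) (fun y => wy (x, y)) (fun y => m (x, y))
    v0 kappa eta eta0 (slice_q S) (slice_q2 S) (slice_g S) (slice_m S) (slice_gE S) Q s s0 QW mQ n n0.
have ci : mu.-integrable I (EFin \o (fun=> 8 * s * n%:R / eta)).
  by apply: continuous_itv_integrable; exact: cst_continuous.
have i1 := @integrable_realZ _ _ R mu I mI (eta * n%:R ^+ 2)^-1 _ (slice_q2 S).
have i2 := @integrable_realZ _ _ R mu I mI (4 / eta) _ (integrable_norm (slice_m S)).
have i3 := @integrable_realD _ _ R mu I mI _ _ (@integrable_realD _ _ R mu I mI _ _ i1 ci) i2.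
rewrite (EFin_Rintegral mI i3).
apply: (le_trans _ ineq); rewrite le_eqVlt; apply/orP; left; apply/eqP.
apply: (etrans _ (@integral_indic _ _ R mu I mI Q mQ)).
apply: ae_eq_integral => //.
- apply/measurable_EFinP; apply: measurable_funTS; exact: (measurable_indic mPx).
- apply/measurable_EFinP; apply: measurable_funTS; exact: (measurable_indic mQ).
have Nae : {ae mu, forall y, ~ N y} by exists N; split=> // y /= /contrapT.
apply: (@filterS3 _ _ (ae_lebesgue_filter R) _ _ _ _ _ Nae (ae_neq (0 : R)) (ae_neq (1 : R))) => y yN y0 y1.
rewrite /= in_itv /= => /andP[yge0 yle1]; congr EFin.
have y01 : 0 < y < 1 by rewrite !lt_neqAle eq_sym y0 y1 yge0.
rewrite !indicE; congr ((nat_of_bool _)%:R); apply/idP/idP; rewrite !inE.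
  by move=> Py; split=> //; split=> //; rewrite /= in_itv.
by move=> [[]].
Qed.

(** On almost every line [Uy] vanishes at almost every point of [Om], so there [m = wy - eta], and
    [wy ^+ 2 + (wy - eta) ^+ 2] is at least [eta ^+ 2 / 2]. *)
Lemma clamped_integral :
  (\int[leb]_(p in II) (eta ^+ 2 / 2 * \1_Om p)%:E <=
   \int[leb]_(p in II) (wy p ^+ 2 * \1_Om p + m p ^+ 2)%:E)%E.
Proof.
have mI : measurable (I : set RR) by exact: measurable_itv.
have mm := measurable_mismatch; have mwy := measurable_L2 Lwy.
have mf : measurable_fun setT (fun p : RR * RR => (eta ^+ 2 / 2 * \1_Om p)%:E).
  by apply/measurable_EFinP; apply: measurable_funM => //; exact: measurable_indic.
have mg : measurable_fun setT (fun p : RR * RR => (wy p ^+ 2 * \1_Om p + m p ^+ 2)%:E).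
  apply/measurable_EFinP; apply: measurable_funD; last exact: measurable_funX.
  by apply: measurable_funM; [exact: measurable_funX|exact: measurable_indic].
have f0 p : (0 <= (eta ^+ 2 / 2 * \1_Om p)%:E)%E.
  by rewrite lee_fin mulr_ge0// divr_ge0// sqr_ge0.
have g0 p : (0 <= (wy p ^+ 2 * \1_Om p + m p ^+ 2)%:E)%E.
  by rewrite lee_fin addr_ge0 ?sqr_ge0// mulr_ge0 ?sqr_ge0// indicE ler0n.
apply: le_integral_setX => //.
apply: filterS slice_dataP => x H Ix; have [v0 [kappa S]] := H Ix.
apply: ae_ge0_le_integral => //.
- by apply: measurable_funTS; exact: (measurableT_comp mf).
- by apply: measurable_funTS; exact: (measurableT_comp mg).
apply: (@filterS3 _ _ (ae_lebesgue_filter R) _ _ _ _ _ (slice_v S) (ae_neq (0 : R)) (ae_neq (1 : R))) => y vy y0 y1 Iy.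
have /andP[yge0 yle1] : 0 <= y <= 1 by move: Iy; rewrite /= in_itv.
have y01 : 0 < y < 1 by rewrite !lt_neqAle eq_sym y0 y1 yge0.
rewrite lee_fin indicE; case: (boolP (_ \in Om)) => [|_]; last first.
  by rewrite !mulr0 add0r sqr_ge0.
rewrite inE !mulr1 => Omy.
have Uy0 : Uy (x, y) = 0 by rewrite (vy Iy); exact: (slice_Om S Omy y01).
have -> : m (x, y) = wy (x, y) - eta by rewrite /m Uy0; ring.
have := sqr_ge0 (2 * wy (x, y) - eta); nra.
Qed.

Lemma bounded_square_integrable (f : RR * RR -> R) (C : R) : measurable_fun setT f ->
  (forall p, `|f p| <= C) -> leb.-integrable II (EFin \o f).
Proof.
move=> mf fC; apply: measurable_bounded_integrable.
- exact: (@measurable_square R).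
- by have := @leb_square R; rewrite /= => ->; rewrite ltry.
- exact: measurable_funTS.
- exists C; split; first exact: num_real.
  by move=> M CM p _ /=; rewrite (le_trans (fC p))// ltW.
Qed.

Lemma Rintegral_square_cst (k : R) : \int[leb]_(p in II) k = k.
Proof.
have e := @Rintegral_cst _ _ R leb II (@measurable_square R) k.
by rewrite e; have := @leb_square R; rewrite /= => ->; rewrite /= mulr1.
Qed.

(** * The bounds in terms of integrals over the square *)

Section bounds.
Variable theta : R.
Hypothesis thetaE : (\int[leb]_(p in II) (\1_Om p)%:E = theta%:E)%E.
Hypothesis theta0 : 0 < theta.
Hypothesis mM : (\int[leb]_(p in II) (m p ^+ 2)%:E <= ((eta * theta / 32) ^+ 2)%:E)%E.
Let A := \int[leb]_(p in II) (w p ^+ 2 * \1_Om p).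
Let B := \int[leb]_(p in II) (Uyy p ^+ 2).
Let D := \int[leb]_(p in II) (wy p ^+ 2 * \1_Om p).
Let N := \int[leb]_(p in II) `|m p|.
Let M := \int[leb]_(p in II) (m p ^+ 2).

Let mII := @measurable_square R.

Let indic_integrable (C : set (RR * RR)) : measurable C ->
  leb.-integrable II (EFin \o (\1_C : RR * RR -> R)).
Proof.
move=> mC; apply: (@bounded_square_integrable _ 1); first exact: measurable_indic.
by move=> p; rewrite indicE; case: (_ \in _); rewrite ?normr1 ?normr0.
Qed.

Let cst_integrable (k : R) : leb.-integrable II (EFin \o (fun=> k)).
Proof. by apply: (@bounded_square_integrable _ `|k|). Qed.

Lemma square_indic_integrable (f : RR * RR -> R) : L2 f ->
  leb.-integrable II (EFin \o (fun p => f p ^+ 2 * \1_Om p)).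
Proof.
move=> Lf; have [_ f2] := L2_integrable Lf.
have mi : measurable_fun II (\1_Om : RR * RR -> R) by exact: measurable_indic.
apply: (@integrable_mul_bounded _ _ R leb II _ _ 1 mII f2 mi) => p _.
by rewrite indicE; case: (_ \in _); rewrite ?normr1 ?normr0.
Qed.

(** Read off [mM]: membership of [Uy] in L2 alone controls [Uy ^+ 2] only in L1. *)
Let m2_integrable : leb.-integrable II (EFin \o (fun p => m p ^+ 2)).
Proof.
have mm := measurable_mismatch.
apply/integrableP; split.
  by apply/measurable_EFinP; apply: measurable_funTS; exact: measurable_funX.
have -> : (fun p => `|(EFin \o (fun p => m p ^+ 2)%R) p|)%E = (fun p => (m p ^+ 2)%:E).
  by apply/funext => p /=; rewrite ger0_norm ?sqr_ge0.
by apply: (le_lt_trans mM); rewrite ltry.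
Qed.

Let m_integrable : leb.-integrable II (EFin \o m).
Proof.
have [wyi _] := L2_integrable Lwy; have [_ Uy2i] := L2_integrable LUy.
have c2 := @integrable_realZ _ _ R leb II mII 2^-1 _ Uy2i.
have := @integrable_realB _ _ R leb II mII _ _
  (@integrable_realD _ _ R leb II mII _ _ wyi c2) (cst_integrable eta).
by congr (integrable _ _ (EFin \o _)); apply/funext => p; rewrite /m mulrC.
Qed.

Let am_integrable : leb.-integrable II (EFin \o (fun p => `|m p|)).
Proof. exact: (integrable_norm m_integrable). Qed.

Let Uyy2_integrable : leb.-integrable II (EFin \o (fun p => Uyy p ^+ 2)).
Proof. by have [] := L2_integrable LUyy. Qed.

Let theta_real : \int[leb]_(p in II) \1_Om p = theta.
Proof. by rewrite /Rintegral thetaE. Qed.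

Lemma mismatch_sqr_le : M <= (eta * theta / 32) ^+ 2.
Proof.
have := mM; rewrite (EFin_Rintegral mII m2_integrable).
by rewrite lee_fin.
Qed.

(** Cauchy-Schwarz on a domain of measure 1, in the form [|m| <= l / 2 + m ^+ 2 / (2 * l)] with [l]
    the claimed bound. *)
Lemma mismatch_le : N <= eta * theta / 32.
Proof.
set l := eta * theta / 32.
have l0 : 0 < l by rewrite /l !mulr_gt0.
have zi := @integrable_realZ _ _ R leb II mII (2 * l)^-1 _ m2_integrable.
have : N <= \int[leb]_(p in II) (l / 2 + (2 * l)^-1 * m p ^+ 2).
  apply: (le_Rintegral mII am_integrable).
    exact: (@integrable_realD _ _ R leb II mII _ _ (cst_integrable (l / 2)) zi).
  move=> p _.
  have e : (`|m p| - l) ^+ 2 / (2 * l) = l / 2 + (2 * l)^-1 * `|m p| ^+ 2 - `|m p|.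
    by field; rewrite gt_eqF.
  rewrite -[m p ^+ 2]real_normK ?num_real// -subr_ge0 -e.
  by rewrite divr_ge0 ?sqr_ge0// mulr_ge0// ltW.
rewrite (RintegralD mII (cst_integrable (l / 2)) zi) Rintegral_square_cst.
rewrite (RintegralZl _ mII m2_integrable) -/M => /le_trans; apply.
have : (2 * l)^-1 * M <= (2 * l)^-1 * l ^+ 2.
  by rewrite ler_wpM2l ?mismatch_sqr_le// invr_ge0 mulr_ge0// ltW.
have -> : (2 * l)^-1 * l ^+ 2 = l / 2 by field; rewrite gt_eqF.
lra.
Qed.

Lemma stretched_le : eta * theta <= B + 2 * N.
Proof.
have z := @integrable_realZ _ _ R leb II mII eta _ (indic_integrable mOm).
have am2 := @integrable_realZ _ _ R leb II mII 2 _ am_integrable.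
have y := @integrable_realD _ _ R leb II mII _ _ Uyy2_integrable am2.
have := stretched_integral; rewrite (EFin_Rintegral mII z) (EFin_Rintegral mII y) lee_fin.
by rewrite (RintegralZl _ mII (indic_integrable mOm)) theta_real
  (RintegralD mII Uyy2_integrable am2) (RintegralZl _ mII am_integrable).
Qed.

Lemma clamped_le : eta ^+ 2 / 2 * theta <= D + M.
Proof.
have z := @integrable_realZ _ _ R leb II mII (eta ^+ 2 / 2) _ (indic_integrable mOm).
have wi := square_indic_integrable Lwy.
have y := @integrable_realD _ _ R leb II mII _ _ wi m2_integrable.
have := clamped_integral; rewrite (EFin_Rintegral mII z) (EFin_Rintegral mII y) lee_fin.
by rewrite (RintegralZl _ mII (indic_integrable mOm)) theta_real
  (RintegralD mII wi m2_integrable).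
Qed.

(** Chebyshev: on [Om], either [w ^+ 2] exceeds [s ^+ 2] or the point lies in the set whose measure
    [small_integral] bounds. *)
Lemma substrate_le (s : R) (n : nat) : 0 <= s -> (0 < n)%N ->
  s ^+ 2 * theta <= A + s ^+ 2 * (B / (eta * n%:R ^+ 2) + 8 * s * n%:R / eta + 4 / eta * N).
Proof.
move=> s0 n0.
have mP : measurable (Om `&` [set p | (`|w p| <= s)%R]).
  exact: measurable_small.
have := small_integral s0 n0; move: mP; set P := Om `&` _ => mP.
have i1 := @integrable_realZ _ _ R leb II mII (eta * n%:R ^+ 2)^-1 _ Uyy2_integrable.
have i2 := @integrable_realZ _ _ R leb II mII (4 / eta) _ am_integrable.
have ci := cst_integrable (8 * s * n%:R / eta).
have i1c := @integrable_realD _ _ R leb II mII _ _ i1 ci.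
have i3 := @integrable_realD _ _ R leb II mII _ _ i1c i2.
have Pi := indic_integrable mP.
rewrite (EFin_Rintegral mII Pi) (EFin_Rintegral mII i3) lee_fin.
rewrite (RintegralD mII i1c i2) (RintegralD mII i1 ci) Rintegral_square_cst.
rewrite (RintegralZl _ mII am_integrable) (RintegralZl _ mII Uyy2_integrable) -/N -/B => small.
have wi := square_indic_integrable Lw.
have sPi := @integrable_realZ _ _ R leb II mII (s ^+ 2) _ Pi.
have sOi := @integrable_realZ _ _ R leb II mII (s ^+ 2) _ (indic_integrable mOm).
have Wi := @integrable_realD _ _ R leb II mII _ _ wi sPi.
have : \int[leb]_(p in II) (s ^+ 2 * \1_Om p) <=
    \int[leb]_(p in II) (w p ^+ 2 * \1_Om p + s ^+ 2 * \1_P p).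
  apply: (le_Rintegral mII sOi Wi) => p _.
  rewrite !indicE; have [pO|pO] := boolP (p \in Om); last first.
    by rewrite !mulr0 add0r mulr_ge0 ?sqr_ge0.
  have [ws|sw] := leP `|w p| s.
    rewrite (mem_set (_ : P p)); last by split=> //; exact/set_mem.
    by rewrite !mulr1 lerDr sqr_ge0.
  rewrite !mulr1 -[w p ^+ 2]real_normK ?num_real//.
  rewrite -[leLHS]addr0 lerD// ?mulr_ge0 ?sqr_ge0//.
  by rewrite lerXn2r ?nnegrE// ltW.
rewrite (RintegralZl _ mII (indic_integrable mOm)) theta_real.
rewrite (RintegralD mII wi sPi) (RintegralZl _ mII Pi) -/A => h.
apply: (le_trans h); rewrite lerD2l ler_wpM2l ?sqr_ge0//.
by rewrite [B / _]mulrC.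
Qed.

End bounds.

End slices.

(** * The energy bound *)

Section arithmetic.
Variable R : realType.
Implicit Types eta theta A B D N M h alpha T : R.

(** With [n ^+ 2] of order [B / (eta * theta)] and [s] of order [eta * theta / n], the three error
    terms in the last hypothesis add up to at most [theta / 2]. *)
Lemma bending_substrate_product eta theta A B D N M :
  0 < eta -> 0 < theta -> theta < 1 ->
  eta * theta <= B + 2 * N -> eta ^+ 2 / 2 * theta <= D + M ->
  N <= eta * theta / 32 -> M <= (eta * theta / 32) ^+ 2 ->
  (forall (s : R) (n : nat), 0 <= s -> (0 < n)%N ->
     s ^+ 2 * theta <= A + s ^+ 2 * (B / (eta * n%:R ^+ 2) + 8 * s * n%:R / eta + 4 / eta * N)) ->
  [/\ 0 < A, 0 < B, 0 < D & eta ^+ 5 * theta ^+ 5 / 2 ^+ 19 <= B * A * D].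
Proof.
move=> e0 t0 t1 hB hD hN hM hA.
have et0 : 0 < eta * theta by rewrite mulr_gt0.
have B15 : 15 / 16 * (eta * theta) <= B by lra.
have B0 : 0 < B by lra.
(* Here [theta < 1] reduces the square [theta ^+ 2] in the bound on [M] to [theta]. *)
have D4 : eta ^+ 2 * theta / 4 <= D.
  have : (eta * theta / 32) ^+ 2 <= eta ^+ 2 * theta / 32 / 32.
    have -> : (eta * theta / 32) ^+ 2 = eta ^+ 2 * theta / 32 / 32 * theta by field.
    by rewrite ler_piMr ?(ltW t1)// !divr_ge0// mulr_ge0 ?sqr_ge0// ltW.
  have : 0 < eta ^+ 2 * theta by rewrite mulr_gt0// exprn_gt0.
  lra.
have D0 : 0 < D by rewrite (lt_le_trans _ D4)// divr_gt0// mulr_gt0// exprn_gt0.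
(* The factor 4 makes the bending error at most [theta / 4]. Since [X >= 1], rounding its square
   root up costs at most a factor 2. *)
pose X := 4 * B / (eta * theta).
have X1 : 1 <= X by rewrite ler_pdivlMr//; lra.
have sX1 : 1 <= Num.sqrt X by rewrite -[leLHS]sqrtr1 ler_wsqrtr.
have sX : Num.sqrt X ^+ 2 = X by rewrite sqr_sqrtr// (le_trans ler01).
pose n := (Num.truncn (Num.sqrt X)).+1.
have /andP[n1 n2] : (Num.truncn (Num.sqrt X))%:R <= Num.sqrt X < n%:R.
  by apply: truncn_itv; exact: sqrtr_ge0.
have n0 : 0 < n%:R :> R by rewrite ltr0n.
have nle : n%:R <= 2 * Num.sqrt X by rewrite /n -natr1; lra.
have Xn : X <= n%:R ^+ 2 by rewrite -sX lerXn2r ?nnegrE ?sqrtr_ge0// ltW.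
have nX : n%:R ^+ 2 <= 4 * X by rewrite -sX; have := sqrtr_ge0 X; nra.
have Bn : B <= n%:R ^+ 2 * (eta * theta) / 4.
  by move: Xn; rewrite /X ler_pdivrMr// => ?; lra.
have nB : n%:R ^+ 2 * (eta * theta) <= 16 * B.
  have : n%:R ^+ 2 * (eta * theta) <= 4 * X * (eta * theta) by rewrite ler_pM2r.
  by rewrite /X => /le_trans; apply; rewrite le_eqVlt; apply/orP; left; apply/eqP; field; rewrite !gt_eqF.
(* Chosen so that [8 * s * n / eta] equals [theta / 8]. *)
pose s := eta * theta / (64 * n%:R).
have s0 : 0 < s by rewrite divr_gt0// mulr_gt0.
have := hA s n (ltW s0) isT.
have b1 : B / (eta * n%:R ^+ 2) <= theta / 4.
  rewrite ler_pdivrMr ?mulr_gt0 ?exprn_gt0//; lra.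
have b2 : 8 * s * n%:R / eta = theta / 8 by rewrite /s; field; rewrite !gt_eqF.
have b3 : 4 / eta * N <= theta / 8.
  by rewrite mulrAC ler_pdivrMr//; lra.
rewrite b2 => hs.
have s20 : 0 < s ^+ 2 by rewrite exprn_gt0.
have As : s ^+ 2 * theta / 2 <= A.
  have : s ^+ 2 * (B / (eta * n%:R ^+ 2) + theta / 8 + 4 / eta * N) <= s ^+ 2 * (theta / 2).
    by rewrite ler_pM2l//; lra.
  lra.
have A0 : 0 < A by rewrite (lt_le_trans _ As)// divr_gt0// mulr_gt0.
split=> //.
(* The lower bound on [B] is proportional to [n ^+ 2] and that on [A] to its inverse, so [n] cancels
   in the product. *)
have BA : eta ^+ 3 * theta ^+ 4 / 2 ^+ 17 <= B * A.
  apply: (@le_trans _ _ (n%:R ^+ 2 * (eta * theta) / 16 * (s ^+ 2 * theta / 2))).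
    by rewrite le_eqVlt; apply/orP; left; apply/eqP; rewrite /s; field; rewrite gt_eqF.
  apply: ler_pM => //; [by rewrite divr_ge0 ?mulr_ge0 ?sqr_ge0// ltW|by rewrite divr_ge0 ?mulr_ge0 ?sqr_ge0// ltW|lra].
apply: (@le_trans _ _ (eta ^+ 3 * theta ^+ 4 / 2 ^+ 17 * (eta ^+ 2 * theta / 4))).
  by rewrite le_eqVlt; apply/orP; left; apply/eqP; field.
apply: ler_pM => //.
  by rewrite divr_ge0 ?mulr_ge0 ?exprn_ge0// ltW.
by rewrite divr_ge0 ?mulr_ge0 ?exprn_ge0// ltW.
Qed.

(** If both summands were below [Q], then the first times the square of the second would be below
    [Q ^+ 3]. That product is [h ^+ 3 * alpha ^+ 2 * (B * A * D)], which is bounded below by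
    hypothesis. *)
Lemma bending_substrate_sum eta theta A B D h alpha T :
  0 < eta -> 0 < theta -> theta < 1 -> 0 < h -> 0 < alpha -> 0 <= T ->
  0 < A -> 0 < B -> 0 < D -> eta ^+ 5 * theta ^+ 5 / 2 ^+ 19 <= B * A * D ->
  T ^+ 3 = alpha ^+ 2 * eta ^+ 5 * theta ^+ 8 ->
  2 ^- 10 * T * h <= h ^+ 3 * B + alpha * Num.sqrt D * Num.sqrt A.
Proof.
move=> e0 t0 t1 h0 a0 T0 A0 B0 D0 BAD T3.
set Q := 2 ^- 10 * T * h.
have Q0 : 0 <= Q by rewrite !mulr_ge0// ?invr_ge0 ?exprn_ge0// ltW.
set S := alpha * Num.sqrt D * Num.sqrt A.
have S0 : 0 <= S by rewrite !mulr_ge0 ?sqrtr_ge0// ltW.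
have S2 : S ^+ 2 = alpha ^+ 2 * D * A.
  by rewrite !exprMn !sqr_sqrtr// ltW.
have hB0 : 0 < h ^+ 3 * B by rewrite mulr_gt0// exprn_gt0.
have [big|small] := leP Q (h ^+ 3 * B); first by rewrite (le_trans big)// lerDl.
suff : Q <= S by move=> /le_trans; apply; rewrite lerDr ltW.
rewrite leNgt; apply/negP => SQ.
have S2Q : S ^+ 2 <= Q ^+ 2 by rewrite lerXn2r ?nnegrE// ltW.
have Qpos : 0 < Q by rewrite (lt_trans hB0).
have lt1 : h ^+ 3 * B * S ^+ 2 < Q ^+ 3.
  rewrite exprS; apply: (@le_lt_trans _ _ (h ^+ 3 * B * Q ^+ 2)).
    by rewrite ler_pM2l.
  by rewrite ltr_pM2r// exprn_gt0.
have ge1 : h ^+ 3 * alpha ^+ 2 * (eta ^+ 5 * theta ^+ 5 / 2 ^+ 19) <= h ^+ 3 * B * S ^+ 2.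
  have -> : h ^+ 3 * B * S ^+ 2 = h ^+ 3 * alpha ^+ 2 * (B * A * D) by rewrite S2; ring.
  by rewrite ler_pM2l// mulr_gt0// exprn_gt0.
have Q3 : Q ^+ 3 = 2 ^- 30 * h ^+ 3 * (alpha ^+ 2 * eta ^+ 5 * theta ^+ 8).
  by rewrite -T3 /Q; field.
(* The product bound carries [theta ^+ 5], the cube of [T] carries [theta ^+ 8]; [theta < 1]
   compares them. *)
have t8 : theta ^+ 8 <= theta ^+ 5.
  by rewrite -[8%N]/(5 + 3)%N exprD ler_piMr ?exprn_ge0 ?exprn_ile1// ltW.
have Z0 : 0 <= h ^+ 3 * alpha ^+ 2 * eta ^+ 5 by rewrite !mulr_ge0 ?exprn_ge0// ltW.
have t50 : 0 <= theta ^+ 5 by rewrite exprn_ge0// ltW.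
have : Q ^+ 3 <= h ^+ 3 * alpha ^+ 2 * (eta ^+ 5 * theta ^+ 5 / 2 ^+ 19).
  have -> : Q ^+ 3 = (h ^+ 3 * alpha ^+ 2 * eta ^+ 5) * (2 ^- 30 * theta ^+ 8) by rewrite Q3; ring.
  have -> : h ^+ 3 * alpha ^+ 2 * (eta ^+ 5 * theta ^+ 5 / 2 ^+ 19) =
     (h ^+ 3 * alpha ^+ 2 * eta ^+ 5) * (2 ^- 19 * theta ^+ 5) by ring.
  apply: ler_wpM2l => //; apply: ler_pM => //; first by rewrite exprn_ge0// ltW.
  by rewrite lef_pV2 ?posrE ?exprn_gt0// ler_eXn2l// ltr1n.
lra.
Qed.

(** Apart from their sign, the real powers enter the estimate only through this cube, a monomial. *)
Lemma powR_cube alpha eta theta : 0 < alpha -> 0 < eta -> 0 < theta ->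
  (alpha `^ (2 / 3) * eta `^ (5 / 3) * theta `^ (8 / 3)) ^+ 3 =
  alpha ^+ 2 * eta ^+ 5 * theta ^+ 8.
Proof.
have cube (x : R) (k : nat) : 0 < x -> (x `^ (k%:R / 3)) ^+ 3 = x ^+ k.
  move=> x0; rewrite -powR_mulrn ?powR_ge0// -powRrM divfK ?pnatr_eq0//.
  by rewrite powR_mulrn// ltW.
by move=> a0 e0 t0; rewrite !exprMn !cube.
Qed.

End arithmetic.

Section energy.
Variable R : realType.
Notation mu := (@lebesgue_measure R).
Local Notation I := (`[(0 : R), 1]%classic).
Local Notation RR := (measurableTypeR R).
Local Notation II := (I `*` I : set (RR * RR)).
Local Notation leb := (mu \x mu)%E.

Lemma measurable_cell : measurable (@cell R : set (RR * RR)).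
Proof. by apply: measurableX; exact: measurable_itv. Qed.

Lemma integral_square_le_cell (f g : RR * RR -> R) :
  measurable_fun setT f -> measurable_fun setT g -> (forall p, 0 <= f p <= g p) ->
  (\int[leb]_(p in II) (f p)%:E <= \int[@leb2 R]_(p in @cell R) (g p)%:E)%E.
Proof.
move=> mf mg fg.
have f0 p : (0 <= (f p)%:E)%E by rewrite lee_fin; have /andP[] := fg p.
have g0 p : (0 <= (g p)%:E)%E by rewrite lee_fin; have /andP[/le_trans] := fg p; apply.
have mf' : measurable_fun setT (EFin \o f) by exact/measurable_EFinP.
have mg' : measurable_fun setT (EFin \o g) by exact/measurable_EFinP.
rewrite (integral_cell_closed mg' g0).
apply: ge0_le_integral => //; first exact: measurable_square.
- exact: measurable_funTS.
- exact: measurable_funTS.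
- by move=> p _; rewrite lee_fin; have /andP[] := fg p.
Qed.

Lemma integral_square_le_cellI (Om : set (RR * RR)) (f g : RR * RR -> R) : measurable Om ->
  measurable_fun setT f -> measurable_fun setT g -> (forall p, 0 <= f p <= g p) ->
  (\int[leb]_(p in II) (f p * \1_Om p)%:E <=
   \int[@leb2 R]_(p in Om `&` @cell R) (g p)%:E)%E.
Proof.
move=> mOm mf mg fg.
have e := @integral_mkcondl _ _ R (@leb2 R) (@cell R) Om (fun p => (g p)%:E).
have gE : (fun p => (g p)%:E) \_ Om = (fun p => (g p * \1_Om p)%:E).
  by apply/funext => p; rewrite patchE indicE; case: ifPn; rewrite ?mulr1 ?mulr0.
rewrite e gE; apply: integral_square_le_cell.
- by apply: measurable_funM => //; exact: measurable_indic.
- by apply: measurable_funM => //; exact: measurable_indic.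
move=> p; have /andP[f0 fgp] := fg p.
by rewrite mulr_ge0 ?ler_wpM2r// indicE ler0n.
Qed.

Lemma H1_weak_dy (f fx fy : R * R -> R) : H1 f fx fy -> [/\ L2 f, L2 fy & weak_dy f fy].
Proof. by move=> [_ [? [_ [? [_ ?]]]]]. Qed.

Lemma H1_measurable (f fx fy : R * R -> R) : H1 f fx fy ->
  [/\ measurable_fun (setT : set (RR * RR)) f, measurable_fun (setT : set (RR * RR)) fx &
      measurable_fun (setT : set (RR * RR)) fy].
Proof. by move=> [_ [[? _] [[? _] [[? _] _]]]]. Qed.

Lemma energy_lower_bound (alpha_m theta h alpha_s eta : R) (c : cand R) :
  0 < alpha_m -> 0 < theta -> theta < 1 -> 0 < h -> 0 < alpha_s -> 0 < eta ->
  admissible theta c ->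
  ((2 ^- 10 * Num.min (alpha_m * eta ^+ 2 * theta ^+ 3)
     (alpha_s `^ (2 / 3) * eta `^ (5 / 3) * theta `^ (8 / 3)) * h)%:E
   <= E_ND alpha_m h alpha_s eta c)%E.
Proof.
move=> am0 t0 t1 h0 as0 e0 [Hw1 [Hw2 [cu [u0 [Hu [Hux [Huy [clOm [_ [OmE uOm]]]]]]]]]].
have [Lw Lwy Dw] := H1_weak_dy Hw2; have [Lu Luy Du] := H1_weak_dy Hu.
have [_ Luyy Duy] := H1_weak_dy Huy.
have [mw1 mw1x mw1y] := H1_measurable Hw1; have [mw2 mw2x mw2y] := H1_measurable Hw2.
have [mu' mux muy] := H1_measurable Hu.
have [_ muxx muxy] := H1_measurable Hux; have [_ muyx muyy] := H1_measurable Huy.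
have mOm : measurable (Om c : set (RR * RR)) by exact: measurable_closed_pair.
have OmI : (\int[leb]_(p in II) (\1_(Om c) p)%:E = theta%:E)%E.
  rewrite -OmE -[RHS](@integral_indic _ _ R (@leb2 R) _ measurable_cell _ mOm).
  apply/esym; apply: (@integral_cell_closed R (fun p => (\1_(Om c) p)%:E)) => //.
  by apply/measurable_EFinP; exact: measurable_indic.
set T := alpha_s `^ (2 / 3) * eta `^ (5 / 3) * theta `^ (8 / 3).
have T0 : 0 <= T by rewrite !mulr_ge0 ?powR_ge0.
have mM11 : measurable_fun (setT : set (RR * RR)) (M11 eta c).
  apply: measurable_funB => //; apply: measurable_funD => //.
  by apply: measurable_funM => //; exact: measurable_funX.
have mM22 : measurable_fun (setT : set (RR * RR)) (M22 eta c).
  apply: measurable_funB => //; apply: measurable_funD => //.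
  by apply: measurable_funM => //; exact: measurable_funX.
have mM12 : measurable_fun (setT : set (RR * RR)) (M12 c).
  apply: measurable_funD; first by apply: measurable_funM => //; exact: measurable_funD.
  by apply: measurable_funM => //; exact: measurable_funM.
have mM21 : measurable_fun (setT : set (RR * RR)) (M21 c).
  apply: measurable_funD; first by apply: measurable_funM => //; exact: measurable_funD.
  by apply: measurable_funM => //; exact: measurable_funM.
set X1 := (\int[@leb2 R]_(p in @cell R)
  (M11 eta c p ^+ 2 + M12 c p ^+ 2 + M21 c p ^+ 2 + M22 eta c p ^+ 2)%:E)%E.
set X2 := (\int[@leb2 R]_(p in @cell R)
  (uxx c p ^+ 2 + uxy c p ^+ 2 + uyx c p ^+ 2 + uyy c p ^+ 2)%:E)%E.
set X3 := (\int[@leb2 R]_(p in Om c `&` @cell R)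
  (w1x c p ^+ 2 + w1y c p ^+ 2 + w2x c p ^+ 2 + w2y c p ^+ 2)%:E)%E.
set X4 := (\int[@leb2 R]_(p in Om c `&` @cell R) (w1 c p ^+ 2 + w2 c p ^+ 2)%:E)%E.
rewrite /E_ND -/X1 -/X2 -/X3 -/X4.
have sq4 (f : RR * RR -> R) : measurable_fun setT f -> measurable_fun setT (fun p => f p ^+ 2).
  by move=> mf; exact: measurable_funX.
have le4 (x y z t : R) : 0 <= t ^+ 2 <= x ^+ 2 + y ^+ 2 + z ^+ 2 + t ^+ 2.
  by rewrite sqr_ge0 lerDr !addr_ge0 ?sqr_ge0.
have meas4 (f1 f2 f3 f4 : RR * RR -> R) : measurable_fun setT f1 -> measurable_fun setT f2 ->
    measurable_fun setT f3 -> measurable_fun setT f4 ->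
    measurable_fun setT (fun p => f1 p ^+ 2 + f2 p ^+ 2 + f3 p ^+ 2 + f4 p ^+ 2).
  by move=> ? ? ? ?; do 3!(apply: measurable_funD; last exact: sq4); exact: sq4.
(* From each density only the square belonging to the second component and the second variable is
   kept; the other squares are nonnegative. *)
have Y1 : (\int[leb]_(p in II) (M22 eta c p ^+ 2)%:E <= X1)%E.
  by apply: integral_square_le_cell; [exact: sq4|exact: meas4|move=> p; exact: le4].
have Y2 : (\int[leb]_(p in II) (uyy c p ^+ 2)%:E <= X2)%E.
  by apply: integral_square_le_cell; [exact: sq4|exact: meas4|move=> p; exact: le4].
have Y3 : (\int[leb]_(p in II) (w2y c p ^+ 2 * \1_(Om c) p)%:E <= X3)%E.
  by apply: integral_square_le_cellI; [|exact: sq4|exact: meas4|move=> p; exact: le4].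
have Y4 : (\int[leb]_(p in II) (w2 c p ^+ 2 * \1_(Om c) p)%:E <= X4)%E.
  apply: integral_square_le_cellI; [exact: mOm|exact: sq4| |].
    by apply: measurable_funD; exact: sq4.
  by move=> p; rewrite sqr_ge0 lerDr sqr_ge0.
have X10 : (0 <= X1)%E.
  by apply: le_trans Y1; apply: integral_ge0 => p _; rewrite lee_fin sqr_ge0.
have X20 : (0 <= X2)%E.
  by apply: le_trans Y2; apply: integral_ge0 => p _; rewrite lee_fin sqr_ge0.
have h30 : 0 <= h ^+ 3 by rewrite exprn_ge0// ltW.
(* Above this threshold the membrane term alone suffices: [32 ^+ 2 = 2 ^+ 10], and
   [theta ^+ 3 <= theta ^+ 2]. *)
have [small|big] := leP (\int[leb]_(p in II) (M22 eta c p ^+ 2)%:E)%E ((eta * theta / 32) ^+ 2)%:E; last first.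
  apply: (@le_trans _ _ ((alpha_m * h)%:E * X1)%E); last first.
    rewrite -addeA leeDl// adde_ge0//; first by rewrite mule_ge0.
    by rewrite !mule_ge0 ?sqrte_ge0// lee_fin ltW.
  apply: (@le_trans _ _ ((alpha_m * h)%:E * ((eta * theta / 32) ^+ 2)%:E)%E); last first.
    apply: lee_wpmul2l; first by rewrite lee_fin mulr_ge0 ?ltW.
    by rewrite (le_trans (ltW big)).
  rewrite -EFinM lee_fin.
  have le1 : Num.min (alpha_m * eta ^+ 2 * theta ^+ 3) T <= alpha_m * eta ^+ 2 * theta ^+ 2.
    rewrite ge_min; apply/orP; left; rewrite ler_wpM2l ?mulr_ge0 ?sqr_ge0 ?ltW//.
    by rewrite exprSr gtr_pMr ?exprn_gt0.
  have -> : alpha_m * h * (eta * theta / 32) ^+ 2 =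
      2 ^- 10 * (alpha_m * eta ^+ 2 * theta ^+ 2) * h by field.
  by rewrite (ler_wpM2r (ltW h0))// ler_wpM2l// invr_ge0 exprn_ge0.
have mII := @measurable_square R.
pose A := \int[leb]_(p in II) (w2 c p ^+ 2 * \1_(Om c) p).
pose B := \int[leb]_(p in II) (uyy c p ^+ 2).
pose D := \int[leb]_(p in II) (w2y c p ^+ 2 * \1_(Om c) p).
have AE : (\int[leb]_(p in II) (w2 c p ^+ 2 * \1_(Om c) p)%:E)%E = A%:E.
  by apply: EFin_Rintegral => //; exact: square_indic_integrable.
have BE : (\int[leb]_(p in II) (uyy c p ^+ 2)%:E)%E = B%:E.
  by apply: EFin_Rintegral => //; have [] := L2_integrable Luyy.
have DE : (\int[leb]_(p in II) (w2y c p ^+ 2 * \1_(Om c) p)%:E)%E = D%:E.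
  by apply: EFin_Rintegral => //; exact: square_indic_integrable.
have [A0 B0 D0 BAD] := bending_substrate_product e0 t0 t1
  (stretched_le e0 Lw Lwy Lu Luy Luyy Dw Du Duy cu u0 uOm mOm OmI)
  (clamped_le Lw Lwy Lu Luy Luyy Dw Du Duy cu u0 uOm mOm OmI small)
  (mismatch_le e0 Lwy Luy t0 small) (mismatch_sqr_le Lwy Luy small)
  (substrate_le e0 Lw Lwy Lu Luy Luyy Dw Du Duy cu u0 uOm mOm OmI).
have T3 := powR_cube as0 e0 t0.
have := bending_substrate_sum e0 t0 t1 h0 as0 T0 A0 B0 D0 BAD T3.
rewrite -/T -lee_fin => fin.
apply: (@le_trans _ _ (2 ^- 10 * T * h)%:E).
  rewrite lee_fin (ler_wpM2r (ltW h0))// ler_wpM2l ?invr_ge0 ?exprn_ge0//.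
  by rewrite ge_min lexx orbT.
apply: (le_trans fin); rewrite EFinD !EFinM.
apply: leeD.
  rewrite -[leLHS]add0e; apply: leeD.
    by rewrite mule_ge0// lee_fin mulr_ge0 ?ltW.
  by apply: lee_wpmul2l; rewrite ?lee_fin// -BE.
apply: lee_pmul.
- by rewrite mule_ge0 ?lee_fin ?sqrtr_ge0// ltW.
- by rewrite lee_fin sqrtr_ge0.
- apply: lee_wpmul2l; first by rewrite lee_fin ltW.
  (* On a finite value [sqrte] computes to [Num.sqrt], so its monotonicity reduces the claim to
     [Y3]. *)
  by rewrite -[leLHS]/(sqrte D%:E) lee_sqrt -?DE// (le_trans _ Y3)// DE lee_fin ltW.
- by rewrite -[leLHS]/(sqrte A%:E) lee_sqrt -?AE// (le_trans _ Y4)// AE lee_fin ltW.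
Qed.

End energy.

Theorem theorem2 (R : realType) :
  exists K4 : R, 0 < K4 /\
  forall alpha_m theta h alpha_s eta : R,
    0 < alpha_m -> 0 < theta -> theta < 1 -> 0 < h -> 0 < alpha_s -> 0 < eta ->
    ((K4 * Num.min (alpha_m * eta ^+ 2 * theta ^+ 3)
                   (alpha_s `^ (2 / 3) * eta `^ (5 / 3) * theta `^ (8 / 3)) * h)%:E
      <= E_min alpha_m h alpha_s eta theta)%E.
Proof.
(* The constant comes from the membrane case; in the other case its cube [2 ^- 30] is well below the
   [2 ^- 19] available. *)
exists (2 ^- 10); split; first by rewrite invr_gt0 exprn_gt0.
move=> alpha_m theta h alpha_s eta am0 t0 t1 h0 as0 e0.
by apply/ereal_infP => _ [c cA <-]; exact: energy_lower_bound.
Qed.
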